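(* Let $\mathcal I$ be the density ideal on $\omega$ generated by a sequence of measures $\langle\mu_n\colon n\in\omega\rangle$. The following are equivalent: (1) $\mathcal I$ is isomorphic to an Erdős–Ulam ideal; (2) $\mathcal I$ does not satisfy the Bolzano–Weierstrass property; (3) the measures satisfy (a) $\sup_n\|\mu_n\|<\infty$ and (b) $\lim_{n\to\infty}\mathrm{at}^+(\mu_n)=0$; (4) the Boolean algebra $\mathcal P(\omega)/\mathcal I$ contains a countable splitting family; (5) $\mathcal I$ is totally bounded; (6) $\mathcal I\equiv_K\mathcal Z$; (7) $\mathcal I^*$ has the Nikodym property.
   Context: An ideal on $\omega$ is a family $\mathcal I$ such that $\mathcal I^*=\{\omega\setminus X:X\in\mathcal I\}$ is a filter containing all cofinite sets. The density ideal generated by a sequence $\langle\mu_n\rangle$ of finitely supported non-negative measures on $\omega$ with pairwise disjoint supports is $\{X\subseteq\omega:\lim_n\mu_n(X)=0\}$ (assumed to be an ideal, i.e. $\omega$ not in it), equivalently $\mathrm{Exh}(\sup_n\mu_n)$, where $\mathrm{Exh}(\varphi)=\{A:\lim_m\varphi(A\setminus[0,m])=0\}$. $\mathrm{at}^+(\mu)=\max\{\mu(\{x\})\}$ over points of the (finite) support. Ideals $\mathcal I,\mathcal J$ are isomorphic if there is a bijection $h$ of $\omega$ with $A\in\mathcal I\iff h[A]\in\mathcal J$. Erdős–Ulam ideal: $\mathrm{Exh}(\varphi_f)$ for $f\colon\omega\to[0,\infty)$ with $\sum f(n)=\infty$ and $f(n)/\sum_{i\le n}f(i)\to0$, where $\varphi_f(A)=\sup_n\sum_{i\in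 A\cap[0,n]}f(i)/\sum_{i\le n}f(i)$. $\mathcal I$ has the Bolzano–Weierstrass property if every bounded real sequence $(x_n)$ has $A\notin\mathcal I$ such that $(x_n)_{n\in A}$ is $\mathcal I$-convergent to some $L$, i.e. $\{n\in A:|x_n-L|\ge\varepsilon\}\in\mathcal I$ for all $\varepsilon>0$. A family $S\subseteq\mathcal P(\omega)/\mathcal I$ is splitting if for every $A\subseteq\omega$ with $A\notin\mathcal I$ there is (a representative) $S\in S$ with $A\cap S\notin\mathcal I$ and $A\setminus S\notin\mathcal I$. A submeasure $\varphi$ on $\omega$ (monotone, subadditive, $\varphi(\emptyset)=0$, finite on singletons) is lower semicontinuous if $\varphi(A)=\lim_n\varphi(A\cap[0,n])$; an analytic P-ideal $\mathcal I$ is totally bounded if every lsc submeasure $\varphi$ with $\mathcal I=\mathrm{Exh}(\varphi)$ has $\varphi(\omega)<\infty$. $\mathcal I\le_K\mathcal J$ if some $f\colon\omega\to\omega$ has $f^{-1}[A]\in\mathcal J$ for all $A\in\mathcal I$; $\equiv_K$ means both directions. $\mathcal Z=\{A:\lim_n|A\cap[2^n,2^{n+1})|/2^n=0\}$. For a free filter $F$, $N_F=\omega\cup\{p_F\}$ has points of $\omega$ isolated and neighbourhoods $A\cup\{p_F\}$, $A\in F$, of $p_F$; $F$ has the Nikodym property if there is no sequence of finitely supported measures $\sum_i\alpha_i\delta_{x_i}$ on $N_F$ with norms $\sum|\alpha_i|\to\infty$ and values on every clopen set tending to $0$. *)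

(* Defs.v *)
From HB Require Import structures.
From mathcomp Require Import all_boot all_order all_algebra finmap.
From mathcomp Require Import all_classical all_reals all_analysis.

Set Implicit Arguments.
Unset Strict Implicit.
Unset Printing Implicit Defensive.

Import Order.TTheory GRing.Theory Num.Theory.
Import numFieldNormedType.Exports.

Local Open Scope classical_set_scope.
Local Open Scope ring_scope.

(** * Ideals on [nat] *)

Definition dual_filter (I : set_system nat) : set_system nat :=
  [set ~` X | X in I].

Definition is_ideal (I : set_system nat) : Prop :=
  ProperFilter (dual_filter I) /\
  forall X : set nat, cofinite_set X -> dual_filter I X.

Definition ideal_isomorphic (I J : set_system nat) : Prop :=
  exists h : nat -> nat, bijective h /\ forall A, I A <-> J (h @` A).

Definition katetov_le (I J : set_system nat) : Prop :=
  exists f : nat -> nat, forall A, I A -> J (f @^-1` A).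

Definition katetov_equiv (I J : set_system nat) : Prop :=
  katetov_le I J /\ katetov_le J I.

(** * Submeasures and exhaustive ideals *)

(* Note that [`I_m.+1] is the interval [0, m]. *)
Definition Exh (R : realType) (phi : set nat -> \bar R) : set_system nat :=
  [set A | phi (A `\` `I_m.+1) @[m --> \oo] --> 0%E].

(* Nonnegativity follows from monotonicity and [phi set0 = 0]. *)
Definition is_submeasure (R : realType) (phi : set nat -> \bar R) : Prop :=
  [/\ phi set0 = 0%E,
      forall A B, A `<=` B -> (phi A <= phi B)%E,
      forall A B, (phi (A `|` B) <= phi A + phi B)%E
    & forall n, (phi [set n] < +oo)%E].

Definition is_lsc (R : realType) (phi : set nat -> \bar R) : Prop :=
  forall A, phi (A `&` `I_n.+1) @[n --> \oo] --> phi A.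

(* To be used for analytic P-ideals, i.e. those [I] which are [Exh phi] for
   some lsc submeasure [phi]. *)
Definition totally_bounded_ideal (R : realType) (I : set_system nat) : Prop :=
  forall phi : set nat -> \bar R,
    is_submeasure phi -> is_lsc phi -> I = Exh phi -> (phi setT < +oo)%E.

(** * Density ideals *)

Definition supp (R : realType) (mu : set nat -> \bar R) : set nat :=
  [set x | mu [set x] != 0%E].

(* The supremum of the masses of all points of [nat]; for a finitely supported
   measure it is the maximum over the points of the support (0 if there are
   none), since all other points have mass 0. *)
Definition at_plus (R : realType) (mu : set nat -> \bar R) : \bar R :=
  ereal_sup [set mu [set x] | x in setT].

Definition density_ideal (R : realType)
    (mu : nat -> {finite_measure set nat -> \bar R}) : set_system nat :=
  [set X | mu n X @[n --> \oo] --> 0%E].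

Definition density_zero_ideal (R : realType) : set_system nat :=
  [set A | ((\sum_(2 ^ n <= i < 2 ^ n.+1) (i \in A))%N%:R / 2 ^+ n : R)
             @[n --> \oo] --> 0].

(** * Erdős–Ulam ideals *)

(* The quotients for which the denominator vanishes are [0 / 0 = 0]. *)
Definition phi_EU (R : realType) (f : nat -> R) (A : set nat) : \bar R :=
  ereal_sup [set ((\sum_(0 <= i < n.+1 | i \in A) f i)
                    / (\sum_(0 <= i < n.+1) f i))%:E | n in setT].

Definition is_Erdos_Ulam (R : realType) (J : set_system nat) : Prop :=
  exists f : nat -> R,
    [/\ forall n, 0 <= f n,
        (\sum_(0 <= i <oo) (f i)%:E = +oo)%E,
        f n / (\sum_(0 <= i < n.+1) f i) @[n --> \oo] --> 0
      & J = Exh (phi_EU f)].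

(** * The Bolzano–Weierstrass property *)

Definition ideal_cvg_on (R : realType) (I : set_system nat) (A : set nat)
    (x : nat -> R) (L : R) : Prop :=
  forall e : R, 0 < e -> I [set n | A n /\ e <= `|x n - L|].

Definition Bolzano_Weierstrass (R : realType) (I : set_system nat) : Prop :=
  forall x : nat -> R, (exists M, forall n, `|x n| <= M) ->
    exists A, ~ I A /\ exists L, ideal_cvg_on I A x L.

(** * Splitting families in the quotient algebra *)

(* The element of P(nat)/I represented by [A]; P(nat)/I is the range of
   [quot_class I]. *)
Definition quot_class (I : set_system nat) (A : set nat) : set (set nat) :=
  [set B | I (A `+` B)].

Definition splitting_family (I : set_system nat)
    (F : set (set (set nat))) : Prop :=
  F `<=` range (quot_class I) /\
  forall A, ~ I A -> exists C S,
    [/\ F C, C S, ~ I (A `&` S) & ~ I (A `\` S)].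

Definition has_countable_splitting_family (I : set_system nat) : Prop :=
  exists F, countable F /\ splitting_family I F.

(** * The space N_F and the Nikodym property *)

(* [None] is the point p_F. *)
Definition N_space (F : set_system nat) : Type := option nat.

HB.instance Definition _ (F : set_system nat) := Choice.on (N_space F).

Definition N_space_base (F : set_system nat) : set (set (N_space F)) :=
  [set U | (exists n : nat, U = [set Some n]) \/
           (exists2 A, F A & U = None |` Some @` A)].

HB.instance Definition _ (F : set_system nat) :=
  isSubBaseTopological.Build (N_space F) (@N_space_base F) id.

Lemma N_space_openE (F : set_system nat) (U : set (N_space F)) :
  open U = exists2 D, D `<=` finI_from (@N_space_base F) id
                    & \bigcup_(B in D) B = U.
Proof. by []. Qed.

Lemma N_space_open_base (F : set_system nat) (U : set (N_space F)) :
  N_space_base U -> open U.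
Proof.
move=> bU; rewrite N_space_openE; exists [set U]; last by rewrite bigcup_set1.
by move=> _ ->; exact: finI_from1.
Qed.

(* For a filter [F], the sets [None |` Some @` A] with [F A] thus form a
   neighbourhood base of [None]. *)
Lemma N_space_nbhs_Some (F : set_system nat) (n : nat) (U : set (N_space F)) :
  nbhs (Some n : N_space F) U <-> U (Some n).
Proof.
split; first exact: nbhs_singleton.
move=> Un; rewrite nbhsE; exists [set (Some n : N_space F)].
  by split=> //; apply: N_space_open_base; left; exists n.
by move=> _ ->.
Qed.

Lemma N_space_nbhs_None (F : set_system nat) (FF : Filter F)
    (U : set (N_space F)) :
  nbhs (None : N_space F) U <-> exists2 A, F A & None |` Some @` A `<=` U.
Proof.
rewrite nbhsE; split=> [[B [oB BN] BU]|[A FA AU]]; last first.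
  exists (None |` Some @` A) => //; split; last by left.
  by apply: N_space_open_base; right; exists A.
move: oB; rewrite N_space_openE => -[D Dfin DB].
move: BN; rewrite -DB => -[C DC CN].
have [E EF EC] := Dfin _ DC.
suff [A FA AE] : exists2 A, F A &
    forall V, V \in E -> (None |` Some @` A : set (N_space F)) `<=` V.
  exists A => //; apply: subset_trans BU => x Ax; rewrite -DB; exists C => //.
  by rewrite -EC => V /= VE; exact: AE Ax.
have EN V : V \in E -> exists2 A, F A & V = None |` Some @` A.
  move=> VE; have := EF _ VE; rewrite inE => -[[n Vn]|//].
  have : V None by move: CN; rewrite -EC; apply.
  by rewrite Vn.
have /choice[EA FEA] : forall V : set (N_space F), exists A,
    V \in E -> F A /\ V = None |` Some @` A.
  move=> V; have [/EN[A FA ->]|_] := boolP (V \in E); first by exists A.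
  by exists set0.
exists (\bigcap_(V in [set` E]) EA V).
  by apply: filter_bigI => V /FEA[].
move=> V VE; have [_ ->] := FEA _ VE; apply: setUS => _ [n An <-].
by exists n => //; exact: An.
Qed.

(* A sequence of finitely supported measures witnessing the failure of the
   Nikodym property; the measure [\sum_x a x * delta_x] is represented by its
   finitely supported function of coefficients [a]. *)
Definition anti_Nikodym_seq (R : realType) (F : set_system nat)
    (a : nat -> N_space F -> R) : Prop :=
  [/\ forall k, finite_set [set x | a k x != 0],
      \sum_(x \in setT) `|a k x| @[k --> \oo] --> +oo
    & forall U : set (N_space F), clopen U ->
        \sum_(x \in U) a k x @[k --> \oo] --> 0].

Definition Nikodym_filter (R : realType) (F : set_system nat) : Prop :=
  ~ exists a : nat -> N_space F -> R, anti_Nikodym_seq a.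

(* Main.v *)
Require Import Defs.
From mathcomp Require Import all_boot all_order all_algebra.
From mathcomp Require Import all_classical all_reals all_analysis.
From mathcomp Require Import lra.

(** Two conditions on an ideal [I] link the seven statements. The first one,
    [has_small_colorings], asks for finite colourings [c 0, c 1, ...] of [nat]
    such that every set which is almost contained in one colour class of each
    [c j] belongs to [I]. It follows from condition (3) by distributing the
    points of each block greedily among [j + 1] colours (a greedy distribution
    over the points of a second block also gives the Katetov reductions of (6)).
    The colour classes form a countable splitting family; the condition is
    inherited along the Katetov order, and it forces every lsc submeasure [phi]
    with [I = Exh phi] to be finite: otherwise some branch of colour classes has
    infinite submeasure, and picking finite pieces of submeasure at least 1 along
    the branch gives a set of [I] outside of [Exh phi].
    The second one, [unbounded_vanishing], asks for finitely supported positive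
    measures with unbounded total masses that converge to 0 on every set of [I].
    It follows from the failure of (3), and it contradicts total boundedness,
    since taking the supremum with these measures does not change [Exh]. By
    Schur's gliding hump argument, it is equivalent to the failure of the Nikodym
    property: if signed measures vanish in the limit on all subsets of [A], then
    so do their total variations on [A].
    For (1), the blocks are enumerated one after the other and the [k]-th one is
    weighted by [2 ^ k], so that it dominates all of its predecessors. *)

Set Implicit Arguments.
Unset Strict Implicit.
Unset Printing Implicit Defensive.

Import Order.TTheory GRing.Theory Num.Theory.
Import numFieldNormedType.Exports.

Local Open Scope classical_set_scope.
Local Open Scope ring_scope.

(** * Convergence and finitely supported measures *)

Section convergence.
Variable R : realType.

Lemma nonneg_cvg0P (u : nat -> R) : (forall n, 0 <= u n) ->
  (u n @[n --> \oo] --> 0) <->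
  (forall e : R, 0 < e -> exists N, forall n, (N <= n)%N -> u n <= e).
Proof.
move=> u0; split=> [/cvgrPdist_le u_to0 e e0|h].
  have [N _ uN] := u_to0 _ e0; exists N => n /uN /=.
  by rewrite sub0r normrN ger0_norm.
apply/cvgrPdist_le => e e0; have [N uN] := h _ e0; exists N => // n /= /uN.
by rewrite sub0r normrN ger0_norm.
Qed.

Lemma nonneg_ecvg0P (u : nat -> \bar R) : (forall n, (0 <= u n)%E) ->
  (u n @[n --> \oo] --> 0%E) <->
  (forall e : R, 0 < e ->
     exists N, forall n, (N <= n)%N -> (u n <= e%:E)%E).
Proof.
move=> u0; split=> [/fine_cvgP[[M _ uM] /cvgrPdist_le u_to0] e e0|h].
  have [N _ uN] := u_to0 _ e0; exists (maxn M N) => n.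
  rewrite geq_max => /andP[/uM /= un /uN /=].
  by rewrite sub0r normrN ger0_norm ?fine_ge0// -lee_fin fineK.
apply/fine_cvgP; split.
  have [N uN] := h _ ltr01; exists N => // n /= /uN un1.
  by rewrite ge0_fin_numE// (le_lt_trans un1) ?ltry.
apply/cvgrPdist_le => e e0; have [N uN] := h _ e0; exists N => // n /= /uN une.
rewrite sub0r normrN ger0_norm ?fine_ge0// -lee_fin fineK//.
by rewrite ge0_fin_numE// (le_lt_trans une) ?ltry.
Qed.

End convergence.

Section weighted_sums.
Variable R : realType.
Implicit Types (s : seq nat) (a : nat -> R) (X Y : set nat).

Definition wsum s a X : R := \sum_(x <- s | x \in X) a x.

Lemma wsum_ge0 s a X : (forall x, 0 <= a x) -> 0 <= wsum s a X.
Proof. by move=> a0; exact: sumr_ge0. Qed.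

Lemma wsum_set0 s a : wsum s a set0 = 0.
Proof. by rewrite /wsum big1// => x; rewrite in_set0. Qed.

Lemma wsum_setT s a : wsum s a setT = \sum_(x <- s) a x.
Proof. by apply: eq_bigl => x; rewrite in_setT. Qed.

Lemma wsum_setID s a X Y : wsum s a X = wsum s a (X `&` Y) + wsum s a (X `\` Y).
Proof.
rewrite /wsum (bigID (mem Y))/=; congr (_ + _); apply: eq_bigl => x.
  by rewrite in_setI.
by rewrite in_setD.
Qed.

Lemma eq_wsum s a X Y : (forall x, x \in s -> X x <-> Y x) ->
  wsum s a X = wsum s a Y.
Proof.
move=> XY; rewrite /wsum big_seq_cond [RHS]big_seq_cond; apply: eq_bigl => x.
by have [xs|//] := boolP (x \in s); apply/idP/idP; rewrite /= !inE => /(XY _ xs).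
Qed.

Lemma le_wsum s a X Y : (forall x, 0 <= a x) -> X `<=` Y ->
  wsum s a X <= wsum s a Y.
Proof.
by move=> a0 XY; rewrite (wsum_setID s a Y X) setIidr// lerDl wsum_ge0.
Qed.

Lemma le_wsum_in s a X Y : (forall x, 0 <= a x) ->
  (forall x, x \in s -> X x -> Y x) -> wsum s a X <= wsum s a Y.
Proof.
move=> a0 XY; rewrite (@eq_wsum s a X (X `&` Y)); last first.
  by move=> x xs; split=> [Xx|[]//]; split=> //; exact: XY.
by apply: le_wsum => // x [].
Qed.

Lemma wsumU_le s a X Y : (forall x, 0 <= a x) ->
  wsum s a (X `|` Y) <= wsum s a X + wsum s a Y.
Proof.
move=> a0; rewrite (wsum_setID s a _ X).
by apply: lerD; apply: le_wsum => // x [[]].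
Qed.

Lemma wsum_ge_mem s a X x : (forall x, 0 <= a x) -> x \in s -> X x ->
  a x <= wsum s a X.
Proof.
move=> a0 xs Xx; rewrite /wsum (big_rem x)//= mem_set// lerDl.
exact: sumr_ge0.
Qed.

Lemma wsum_eq0 s a X : (forall x, x \in s -> ~ X x) -> wsum s a X = 0.
Proof.
move=> sX; rewrite /wsum big_seq_cond big1// => x /andP[/sX Xx].
by rewrite inE.
Qed.

Lemma wsum_cat s t a X : wsum (s ++ t) a X = wsum s a X + wsum t a X.
Proof. exact: big_cat. Qed.

Lemma wsum_tail_eq0 s a : exists N, forall m X, (N <= m)%N ->
  wsum s a (X `\` `I_m) = 0.
Proof.
exists (\max_(x <- s) x).+1 => m X Nm; apply: wsum_eq0 => x xs [_ /=]; apply.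
by rewrite (leq_trans _ Nm)// ltnS leq_bigmax_seq.
Qed.

End weighted_sums.

(** * Ideals and colourings *)

Section ideals.
Variable I : set_system nat.
Hypothesis idealI : is_ideal I.

Lemma dual_filterC A : dual_filter I (~` A) <-> I A.
Proof.
split=> [[B IB /(congr1 setC)]|IA]; last by exists A.
by rewrite !setCK => <-.
Qed.

Lemma idealS A B : A `<=` B -> I B -> I A.
Proof.
have [PF _] := idealI.
by move=> AB /dual_filterC IB; apply/dual_filterC; apply: filterS IB => x nBx /AB.
Qed.

Lemma idealU A B : I A -> I B -> I (A `|` B).
Proof.
have [PF _] := idealI.
move=> /dual_filterC IA /dual_filterC IB; apply/dual_filterC.
by rewrite setCU; exact: filterI.
Qed.

Lemma ideal_finite A : finite_set A -> I A.
Proof.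
by have [_ cof] := idealI; move=> fA; apply/dual_filterC/cof; rewrite setCK.
Qed.

Lemma ideal_proper : ~ I setT.
Proof.
have [PF _] := idealI.
by move=> /dual_filterC; rewrite setCT; exact: filter_not_empty.
Qed.

End ideals.

(** * Small colourings and splitting families *)

Section colorings.

(* The exceptional sets range over [S], which is either [J] itself or the family
   of finite sets. *)
Definition has_small_colorings (J S : set_system nat) : Prop :=
  exists c : nat -> nat -> nat,
    (forall j, exists m, forall x, (c j x < m)%N) /\
    forall (p : nat -> nat) A,
      (forall j, S (A `&` [set x | c j x != p j])) -> J A.

Lemma has_small_coloringsS J S S' : S' `<=` S ->
  has_small_colorings J S -> has_small_colorings J S'.
Proof.
move=> SS' [c [cb cJ]]; exists c; split=> // p A h.
by apply: (cJ p) => j; exact/SS'.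
Qed.

(** The colourings are pulled back along [f]. It matters that the exceptional sets are finite: their
    images under [f] are again finite, whereas [f] need not map sets of [I] into [J]. Hence the
    image of [A] lies in [J], and [A] is contained in the preimage of its image. *)
Lemma katetov_small_colorings I J : is_ideal I -> katetov_le J I ->
  has_small_colorings J finite_set -> has_small_colorings I finite_set.
Proof.
move=> idI [f fJI] [c [cb cJ]]; exists (fun j x => c j (f x)); split.
  by move=> j; have [m cm] := cb j; exists m.
move=> p A finA; apply: (idealS idI (@preimage_image _ _ f A)).
apply/fJI/(cJ p) => j; apply: sub_finite_set (finite_image f (finA j)).
by move=> _ [[x Ax <-] /= cx]; exists x.
Qed.

(** [P] stands for a notion of largeness: it is applied to the sets outside an ideal and to the sets
    of infinite submeasure. *)
Lemma class_partition (P : set_system nat) (c : nat -> nat) m A :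
  (forall B C, P (B `|` C) -> P B \/ P C) -> ~ P set0 ->
  (forall x, (c x < m)%N) -> P A -> exists i, P (A `&` [set x | c x = i]).
Proof.
move=> PU P0 cm PA.
suff h n : P (A `&` [set x | (c x < n)%N]) ->
    exists i, P (A `&` [set x | c x = i]).
  apply: (h m); rewrite (_ : [set x | _] = setT) ?setIT//.
  by apply/seteqP; split=> x _ //=.
elim: n => [|n ih].
  by rewrite (_ : [set x | _] = set0) ?setI0//; apply/seteqP; split=> x.
rewrite (_ : [set x | _] = [set x | (c x < n)%N] `|` [set x | c x = n]);
  last first.
  apply/seteqP; split=> x /=.
    by rewrite ltnS leq_eqVlt => /orP[/eqP|]; [right|left].
  by move=> [/ltnW|->].
by rewrite setIUr => /PU[/ih//|]; exists n.
Qed.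

(** Descent along the colourings: [C j.+1] is the trace on [C j] of a class of [c j] chosen so that
    this trace is still large. *)
Lemma class_branch (P : set_system nat) (c : nat -> nat -> nat) :
  (forall B C, P (B `|` C) -> P B \/ P C) -> ~ P set0 ->
  (forall j, exists m, forall x, (c j x < m)%N) -> P setT ->
  exists p : nat -> nat, exists C : nat -> set nat,
    [/\ forall j, P (C j), forall j, C j.+1 `<=` C j &
        forall j, C j.+1 `<=` [set x | c j x = p j]].
Proof.
move=> PU P0 cb PT.
have /choice[F FP] : forall jA : nat * set nat, exists i, P jA.2 ->
    P (jA.2 `&` [set x | c jA.1 x = i]).
  move=> [j A] /=; have [PA|nPA] := pselect (P A); last by exists 0%N.
  have [m cm] := cb j.
  by have [i Pi] := class_partition PU P0 cm PA; exists i.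
pose fix C j := if j is j'.+1 then
  C j' `&` [set x | c j' x = F (j', C j')] else setT.
exists (fun j => F (j, C j)), C; split=> [j|j x []//|j x []//].
by elim: j => // j ih; exact: (FP (j, C j)).
Qed.

(** The family consists of all colour classes. If none of them splits [A], then for each [j] some
    class of [c j] contains [A] modulo [I], and smallness puts [A] in [I]. *)
Lemma small_colorings_splitting (I : set_system nat) : is_ideal I ->
  has_small_colorings I I -> has_countable_splitting_family I.
Proof.
move=> idI [c [cb cI]].
pose cls ji := quot_class I [set x | c ji.1 x = ji.2].
exists (range cls); split; first exact: sub_countable (card_image_le _ _) (countableP _).
split; first by move=> _ [ji _ <-]; eexists.
move=> A nIA; apply: contrapT => nsplit.
have ndec j i : ~ I (A `&` [set x | c j x = i]) -> I (A `\` [set x | c j x = i]).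
  move=> nI; apply: contrapT => nI'; apply: nsplit.
  exists (cls (j, i)), [set x | c j x = i]; split=> //.
  by rewrite /cls /quot_class /= setYK; exact: (ideal_finite idI).
have /choice[p pI] : forall j, exists i, I (A `\` [set x | c j x = i]).
  move=> j; have [m cm] := cb j.
  have [i /ndec nI] : exists i, ~ I (A `&` [set x | c j x = i]).
    apply: (class_partition (P := fun X => ~ I X) _ _ cm nIA) => [B C nBC|].
      rewrite -not_andE => -[IB IC]; exact/nBC/(idealU idI).
    by apply; exact: (ideal_finite idI).
  by exists i.
apply/nIA/(cI p) => j; apply: (idealS idI _ (pI j)) => x /= [Ax /eqP cx].
by split.
Qed.

End colorings.

(** * Countable splitting families refute the Bolzano-Weierstrass property *)

Section splitting_sequence.
Variable R : realType.

(** The sum of [d i / 3 ^ i] over [i < N]. With digits 0 and 1, base 3 leaves gaps between different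
    digit strings, as in the Cantor set. *)
Fixpoint ternary (d : nat -> bool) (N : nat) : R :=
  if N is N'.+1 then (d 0%N)%:R + 3^-1 * ternary (fun i => d i.+1) N' else 0.

Lemma ternary_bounds d N : 0 <= ternary d N <= 3 / 2.
Proof.
elim: N d => [|N ih] d /=; first by lra.
by have := ih (fun i => d i.+1); case: (d 0%N) => /=; lra.
Qed.

(** At the first differing digit the gap is at least [1 - 3^-1 * (3 / 2) = 1 / 2] at the scale of
    that digit, whatever follows; this first digit comes no later than [i]. *)
Lemma ternary_sep d d' i N N' : d i != d' i -> (i < N)%N -> (i < N')%N ->
  3^-1 ^+ i / 2 <= `|ternary d N - ternary d' N'|.
Proof.
elim: i d d' N N' => [|i ih] d d' [//|N] [//|N'] /= ddi iN iN'.
  have := ternary_bounds (fun i => d i.+1) N.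
  have := ternary_bounds (fun i => d' i.+1) N'.
  rewrite expr0; move: ddi; case: (d 0%N); case: (d' 0%N) => //= _ h1 h2.
    by rewrite ger0_norm; lra.
  by rewrite ler0_norm; lra.
have ih' := ih (fun i => d i.+1) (fun i => d' i.+1) N N' ddi iN iN'.
have := ternary_bounds (fun i => d i.+1) N.
have := ternary_bounds (fun i => d' i.+1) N'.
set X := ternary _ N in ih' *; set X' := ternary _ N' in ih' * => h1 h2.
have [->|] := eqVneq (d 0%N) (d' 0%N).
  rewrite opprD addrACA subrr add0r -mulrBr normrM ger0_norm ?invr_ge0// exprS -mulrA.
  by rewrite ler_wpM2l// invr_ge0.
have : 3^-1 ^+ i.+1 <= 1 :> R by apply: exprn_ile1; lra.
case: (d 0%N); case: (d' 0%N) => //= h3 _.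
  by rewrite ger0_norm; lra.
by rewrite ler0_norm; lra.
Qed.

(** The sequence codes by ternary digits which members of the family contain [n]. If it converges on
    [A] modulo [I], then its [j]-th digit is constant on [A] modulo [I], so the [j]-th member does
    not split [A]. *)
Lemma countable_splitting_nBW (I : set_system nat) : is_ideal I ->
  has_countable_splitting_family I -> ~ Bolzano_Weierstrass R I.
Proof.
move=> idI [F [/countable_injP[f finj] [FI Fsplit]]] BW.
(* [S j] represents the class with code [j], and is empty if there is no such class. *)
have /choice[S FS] : forall j, exists S, forall C, F C -> f C = j ->
    C = quot_class I S.
  move=> j; have [[C [FC fC]]|nC] := pselect (exists C, F C /\ f C = j).
    have [S _ CS] := FI _ FC; exists S => D FD fD; rewrite CS.
    by apply: finj; rewrite ?inE// fC.
  by exists set0 => C FC fC; exfalso; apply: nC; exists C.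
(* Keeping [n.+1] digits makes the [j]-th digit visible in [x n] as soon as [j <= n]. *)
pose x n := ternary (fun j => n \in S j) n.+1.
have [|A [nIA [L AL]]] := BW x.
  exists (3 / 2) => n; have := ternary_bounds (fun j => n \in S j) n.+1.
  by rewrite -/(x n) => /andP[x0 x1]; rewrite ger0_norm.
have [C [T [FC CT nIT nIT']]] := Fsplit A nIA.
(* Two points within [e] of [L] are less than [2 / 5 * 3^-1 ^+ j] apart, which is below the
   separation [3^-1 ^+ j / 2]. *)
set j := f C; pose e : R := 3^-1 ^+ j / 5.
have e0 : 0 < e by rewrite divr_gt0// exprn_gt0// invr_gt0.
have Ie := AL _ e0.
have IST : I (S j `+` T) by move: CT; rewrite (FS j C FC erefl).
(* The exceptional points: those with values far from [L], those whose [j]-th digit is cut off, and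
   those where the representatives [S j] and [T] disagree. *)
pose N := [set n | A n /\ e <= `|x n - L|] `|` `I_j `|` (S j `+` T).
have IN : I N by apply: (idealU idI) => //; apply: (idealU idI) => //; exact: (ideal_finite idI).
have same n m : A n -> ~ N n -> A m -> ~ N m -> S j n -> S j m.
  move=> An Nn Am Nm Sn; apply: contrapT => Sm.
  have ltN k : ~ N k -> (j < k.+1)%N.
    by move=> Nk; rewrite ltnS leqNgt; apply/negP => kj; apply: Nk; left; right.
  have : 3^-1 ^+ j / 2 <= `|x n - x m|.
    by apply: ternary_sep; rewrite ?ltN// (mem_set Sn) (memNset Sm).
  have lte k : A k -> ~ N k -> `|x k - L| < e.
    by move=> Ak Nk; rewrite ltNge; apply/negP => ek; apply: Nk; left; left.
  have := ler_distD L (x n) (x m); have := lte _ An Nn.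
  by rewrite (distrC L); have := lte _ Am Nm; move: e0; rewrite /e; lra.
have [n nAT] : exists n, (A `&` T) n /\ ~ N n.
  apply: contrapT => h; apply/nIT/(idealS idI _ IN) => n An.
  by apply: contrapT => Nn; apply: h; exists n.
have [m mAT] : exists n, (A `\` T) n /\ ~ N n.
  apply: contrapT => h; apply/nIT'/(idealS idI _ IN) => n' An.
  by apply: contrapT => Nn; apply: h; exists n'.
move: nAT mAT => [[An Tn] Nn] [[Am Tm] Nm].
have Sn : S j n by apply: contrapT => Sn; apply: Nn; right; right.
have := same _ _ An Nn Am Nm Sn => Sm; apply: Nm; right.
by left.
Qed.

End splitting_sequence.

(** * Submeasures *)

Section submeasures.
Variables (R : realType) (phi : set nat -> \bar R).
Hypotheses (phi_sub : is_submeasure phi) (phi_lsc : is_lsc phi).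

Lemma submeasure_ge0 A : (0 <= phi A)%E.
Proof. by have [<- mono _ _] := phi_sub; exact: mono. Qed.

Lemma ExhP A : Exh phi A <->
  forall e : R, 0 < e ->
    exists N, forall n, (N <= n)%N -> (phi (A `\` `I_n.+1) <= e%:E)%E.
Proof. by apply: nonneg_ecvg0P => n; exact: submeasure_ge0. Qed.

Lemma submeasure_initial_lty m : (phi `I_m < +oo)%E.
Proof.
have [phi0 mono subadd phi1] := phi_sub.
elim: m => [|m ih]; first by rewrite II0 phi0.
by rewrite IIS (le_lt_trans (subadd _ _))// lte_add_pinfty.
Qed.

(** Lower semicontinuity provides finite sets [F j] inside [C j], beyond [j] and of submeasure at
    least 1. Every tail of their union contains some [F j], so the union is not in [Exh phi]; and
    only the [F i] with [i < j] can leave [C j]. *)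
Lemma lsc_submeasure_pseudo_intersection (C : nat -> set nat) :
  (forall j, C j.+1 `<=` C j) -> (forall j, phi (C j) = +oo%E) ->
  exists A, ~ Exh phi A /\ forall j, finite_set (A `\` C j).
Proof.
have [phi0 mono subadd phi1] := phi_sub.
move=> Cdec Coo.
have /choice[F FP] : forall j, exists F,
    [/\ finite_set F, F `<=` C j `\` `I_j & (1%:E <= phi F)%E].
  move=> j; set X := C j `\` `I_j.
  have oo : phi X = +oo%E.
    apply/eqP; rewrite -leye_eq leNgt; apply/negP => lt.
    have : (phi (C j) < +oo)%E; last by rewrite Coo.
    apply: le_lt_trans (lte_add_pinfty lt (submeasure_initial_lty j)).
    apply: le_trans (subadd _ _); apply: mono => x Cx.
    by have [xj|xj] := pselect (`I_j x); [right|left].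
  have := @phi_lsc X; rewrite oo => /cvgey_ge/(_ 1)[N _ /(_ N (leqnn N))/= h].
  exists (X `&` `I_N.+1); split=> //.
  exact: sub_finite_set (@subIsetr _ _ _) (finite_II _).
exists (\bigcup_j F j); split.
  move=> /ExhP/(_ (1 / 2)) []; first by lra.
  move=> N /(_ N (leqnn N)); apply/negP; rewrite -ltNge.
  have [_ FN leF] := FP N.+1; apply: lt_le_trans (le_trans leF (mono _ _ _)).
    by rewrite lte_fin; lra.
  by move=> x Fx; split; [exists N.+1|case: (FN x Fx)].
move=> j; apply: sub_finite_set (bigcup_finite (finite_II j) (F := F) _).
  2: by move=> i _; case: (FP i).
move=> x [[i _ Fix] nCx]; exists i => //=; rewrite ltnNge; apply/negP => ji.
apply: nCx; have [_ /(_ _ Fix)[Cx _] _] := FP i.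
elim: i ji Cx {Fix} => [|i ih]; first by rewrite leqn0 => /eqP->.
by rewrite leq_eqVlt => /orP[/eqP->//|ji] /Cdec; exact: ih.
Qed.

(** The sets whose complement has finite submeasure form a proper filter. By compactness [x] has a
    cluster point [L] along it, so every set [C j] of points with values close to [L] has infinite
    submeasure. Along a pseudo-intersection of the [C j] outside the ideal, [x] converges to [L] in
    the ordinary sense. *)
Lemma unbounded_submeasure_BW : is_ideal (Exh phi) -> phi setT = +oo%E ->
  Bolzano_Weierstrass R (Exh phi).
Proof.
have [phi0 mono subadd phi1] := phi_sub.
move=> idI phioo x [M xM].
pose G : set_system nat := [set X | (phi (~` X) < +oo)%E].
have GP : ProperFilter G.
  split; first by rewrite /G /= setC0 phioo.
  split; first by rewrite /G /= setCT phi0.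
    move=> X Y GX GY; rewrite /G /= setCI.
    exact: le_lt_trans (subadd _ _) (lte_add_pinfty GX GY).
  by move=> X Y XY; apply: le_lt_trans; apply: mono => n nY /XY.
have [|L [_ clL]] := @segment_compact R (- M) M (fmap x G) _.
  have E : x @^-1` `[- M, M] = setT.
    by apply/seteqP; split=> // n _; rewrite /= in_itv/= -ler_norml.
  by rewrite /fmap /G /mkset E setCT phi0.
pose C (j : nat) := [set n | `|x n - L| < j.+1%:R^-1].
have Coo j : phi (C j) = +oo%E.
  apply/eqP; rewrite -leye_eq leNgt; apply/negP => lt.
  have [||y [/= h1]] := clL [set y | j.+1%:R^-1 <= `|y - L|] (ball L j.+1%:R^-1).
  - have E : ~` (x @^-1` [set y | j.+1%:R^-1 <= `|y - L|]) = C j.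
      apply/seteqP; split=> n /=; first by move/negP; rewrite -ltNge.
      by move=> h; apply/negP; rewrite -ltNge.
    by rewrite /fmap /G /mkset E.
  - by apply: nbhsx_ballx; rewrite invr_gt0.
  - by rewrite -ball_normE /= distrC ltNge h1.
have [j n|A [nIA Afin]] := lsc_submeasure_pseudo_intersection _ Coo.
  by move=> /lt_le_trans; apply; rewrite lef_pV2 ?posrE// ler_nat.
exists A; split=> //; exists L => e e0; apply: (ideal_finite idI).
have [j je] : exists j, j.+1%:R^-1 < e.
  by exists (Num.trunc e^-1); rewrite invf_plt ?posrE// truncnS_gt.
apply: sub_finite_set (Afin j) => n [An en]; split=> //= lt.
by move: en; apply/negP; rewrite -ltNge (lt_trans lt).
Qed.

Lemma small_colorings_submeasure_lty :
  has_small_colorings (Exh phi) finite_set -> (phi setT < +oo)%E.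
Proof.
have [phi0 mono subadd phi1] := phi_sub.
move=> [c [cb cE]]; rewrite ltNge leye_eq; apply/negP => /eqP phioo.
have [||p [C [Coo Cdec Cp]]] :=
  class_branch (P := fun C => phi C = +oo%E) _ _ cb phioo.
- move=> B C BC; apply: contrapT => /not_orP[].
  move=> /eqP; rewrite -leye_eq -ltNge => h1 /eqP; rewrite -leye_eq -ltNge => h2.
  by have := le_lt_trans (subadd B C) (lte_add_pinfty h1 h2); rewrite BC.
- by rewrite phi0.
have [A [nEA Afin]] := lsc_submeasure_pseudo_intersection Cdec Coo.
apply/nEA/(cE p) => j; apply: sub_finite_set (Afin j.+1) => x [Ax /= /eqP cx].
by split=> // /Cp.
Qed.

End submeasures.

Lemma small_colorings_totally_bounded (R : realType) (I : set_system nat) :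
  has_small_colorings I finite_set -> totally_bounded_ideal R I.
Proof.
by move=> cI phi sub lsc IE; apply: small_colorings_submeasure_lty; rewrite -?IE.
Qed.

Lemma not_BW_totally_bounded (R : realType) (I : set_system nat) : is_ideal I ->
  ~ Bolzano_Weierstrass R I -> totally_bounded_ideal R I.
Proof.
move=> idI nBW phi sub lsc IE; rewrite ltNge leye_eq; apply/negP => /eqP oo.
by apply: nBW; rewrite IE; apply: unbounded_submeasure_BW; rewrite -?IE.
Qed.

(** * Suprema of sequences of submeasures *)

Section sup_of_submeasures.
Variables (R : realType) (th : nat -> set nat -> R).
Hypothesis th0 : forall n, th n set0 = 0.
Hypothesis th_mono : forall n A B, A `<=` B -> th n A <= th n B.
Hypothesis th_subadd : forall n A B, th n (A `|` B) <= th n A + th n B.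
Hypothesis th_tail : forall n, exists N, forall m A, (N <= m)%N ->
  th n (A `\` `I_m) = 0.
Hypothesis th_pt : forall x, th n [set x] @[n --> \oo] --> 0.

Definition sup_submeasure (A : set nat) : \bar R :=
  ereal_sup [set (th n A)%:E | n in setT].

Let th_ge0 n A : 0 <= th n A.
Proof. by rewrite -(th0 n); exact: th_mono. Qed.

Let th_le n A : ((th n A)%:E <= sup_submeasure A)%E.
Proof. by apply: ereal_sup_ubound; exists n. Qed.

Lemma sup_submeasureP : is_submeasure sup_submeasure.
Proof.
split=> [|A B AB|A B|x].
- apply/eqP; rewrite eq_le; apply/andP; split.
    by apply/ereal_supP => _ [n _ <-]; rewrite th0.
  by have := th_le 0%N set0; rewrite th0.
- apply/ereal_supP => _ [n _ <-]; apply: le_trans (th_le n B).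
  by rewrite lee_fin th_mono.
- apply/ereal_supP => _ [n _ <-]; apply: le_trans (leeD (th_le n A) (th_le n B)).
  by rewrite -EFinD lee_fin th_subadd.
- have /nonneg_cvg0P/(_ 1 ltr01)[//|N hN] := th_pt x.
  (* By [th_pt] the values on a point are at most 1 from [N] on; the sum bounds the finitely many
     earlier ones. *)
  apply: (@le_lt_trans _ _ (1 + \sum_(i < N) th i [set x])%:E); last exact: ltry.
  apply/ereal_supP => _ [n _ <-]; rewrite lee_fin.
  have [Nn|nN] := leqP N n; first by rewrite (le_trans (hN _ Nn))// lerDl sumr_ge0.
  rewrite (bigD1 (Ordinal nN))//= addrCA lerDl addr_ge0// sumr_ge0//.
Qed.

Lemma sup_submeasure_lsc : is_lsc sup_submeasure.
Proof.
have [_ mono _ _] := sup_submeasureP.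
move=> A; rewrite (_ : sup_submeasure A =
    ereal_sup (range (fun n => sup_submeasure (A `&` `I_n.+1)))).
  apply: ereal_nondecreasing_cvgn => m n mn; apply: mono => x [Ax xm]; split=> //.
  exact: leq_trans xm _.
apply/eqP; rewrite eq_le; apply/andP; split; apply/ereal_supP => _ [n _ <-].
  have [N hN] := th_tail n; apply: le_trans (ereal_sup_ubound _); last by exists N.
  apply: le_trans (th_le n _); rewrite lee_fin.
  have <- : (A `&` `I_N.+1) `|` (A `\` `I_N.+1) = A by rewrite setUIDK.
  by rewrite (le_trans (th_subadd _ _ _))// hN ?addr0// setUIDK.
by apply: mono => x [].
Qed.

Let th_initial k : th n `I_k @[n --> \oo] --> 0.
Proof.
elim: k => [|k /nonneg_cvg0P ih]; apply/nonneg_cvg0P => // e e0.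
  by exists 0%N => n _; rewrite II0 th0 ltW.
have e2 : 0 < e / 2 by rewrite divr_gt0.
have [//|N hN] := ih _ (e / 2) e2.
have /nonneg_cvg0P/(_ (e / 2) e2)[//|M hM] := th_pt k.
exists (maxn N M) => n; rewrite geq_max => /andP[/hN h1 /hM h2].
by rewrite IIS (le_trans (th_subadd _ _ _))// (le_trans (lerD h1 h2))// -splitr.
Qed.

(** For one inclusion, the values on a fixed initial segment tend to 0 by [th_initial], and the tail
    is uniformly small. For the other, the finitely many [th n] with [n < N] vanish on far tails by
    [th_tail]. *)
Lemma Exh_sup_submeasure : Exh sup_submeasure = [set A | th n A @[n --> \oo] --> 0].
Proof.
apply/seteqP; split=> A /=.
  move=> /(ExhP sup_submeasureP) EA; apply/nonneg_cvg0P => // e e0.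
  have e2 : 0 < e / 2 by rewrite divr_gt0.
  have [m /(_ _ (leqnn _)) EAm] := EA _ e2.
  have /nonneg_cvg0P/(_ (e / 2) e2)[//|N hN] := th_initial m.+1.
  exists N => n /hN thI.
  have := le_trans (th_le n _) EAm; rewrite lee_fin => thA.
  rewrite [e]splitr (le_trans _ (lerD thI thA))// (le_trans _ (th_subadd _ _ _))//.
  by apply: th_mono => x Ax; have [xm|xm] := pselect (`I_m.+1 x); [left|right].
move=> /nonneg_cvg0P hA; apply/(ExhP sup_submeasureP) => e e0.
have [//|N hN] := hA _ e e0; have /choice[T hT] := th_tail.
exists (\max_(n < N) T n) => m Km; apply/ereal_supP => _ [n _ <-]; rewrite lee_fin.
have [Nn|nN] := leqP N n; first by rewrite (le_trans _ (hN _ Nn))// th_mono// => x [].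
rewrite hT ?ltW// (leq_trans _ (leqW Km))//.
exact: (leq_bigmax_cond (Ordinal nN)).
Qed.

Lemma sup_submeasure_setT_oo : (forall M, exists n, M <= th n setT) ->
  sup_submeasure setT = +oo%E.
Proof.
move=> h; apply/eqyP => M _; have [n hn] := h M.
by apply: le_trans (th_le n _); rewrite lee_fin.
Qed.

End sup_of_submeasures.

(** * Block systems *)

Section assignments.
Variable R : realType.
Implicit Types (s bins : seq nat) (a q : nat -> R).

Lemma wsum_fibers s bins a (f : nat -> nat) A : uniq bins ->
  (forall x, x \in s -> f x \in bins) ->
  wsum s a (f @^-1` A) =
  \sum_(y <- bins | y \in A) wsum s a [set x | f x = y].
Proof.
move=> ubins fbins; rewrite /wsum (exchange_big_dep (fun x => f x \in A))/=; last first.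
  by move=> y x yA; rewrite inE/= => ->.
rewrite (eq_bigl (fun x => f x \in A)); last first.
  by move=> x; apply/idP/idP; rewrite !inE.
rewrite big_seq_cond [RHS]big_seq_cond; apply: eq_bigr => x /andP[xs fxA].
rewrite (eq_bigl (pred1 (f x))) => [|y /=].
  by rewrite -big_filter filter_pred1_uniq ?fbins// big_seq1.
apply/idP/eqP => [/andP[_]|->]; first by rewrite inE/= => ->.
by rewrite fxA inE.
Qed.

(** Each point goes to a bin whose load does not yet exceed its capacity [q y]; one exists, since
    otherwise the total load would exceed the total capacity. A bin thus overflows by at most one
    atom. As [eps] is quantified after [c], one assignment serves all bounds on the atoms. *)
Lemma greedy_assignment a s bins q : (forall x, 0 <= a x) -> uniq s ->
  uniq bins -> bins != [::] -> (forall y, 0 <= q y) ->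
  \sum_(x <- s) a x <= \sum_(y <- bins) q y ->
  exists c : nat -> nat, (forall x, c x \in bins) /\
    forall y (eps : R), y \in bins -> 0 <= eps -> (forall x, x \in s -> a x <= eps) ->
      wsum s a [set x | c x = y] <= q y + eps.
Proof.
move=> a0 + ubins bins0 q0; elim: s => [_ _|z s ih /= /andP[zs us]].
  case: bins bins0 {ubins} => // y0 bins _; exists (fun=> y0).
  split=> [x|y eps _ eps0 _].
    by rewrite mem_head.
  by rewrite /wsum big_nil addr_ge0.
rewrite big_cons => sumle.
have [|c [cbins cle]] := ih us; first by rewrite (le_trans _ sumle)// lerDr.
have [y0 y0bins y0le] : exists2 y, y \in bins & wsum s a [set x | c x = y] <= q y.
  apply: contrapT => h.
  have : \sum_(y <- bins) q y < \sum_(y <- bins) wsum s a [set x | c x = y].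
    rewrite big_seq [ltRHS]big_seq; apply: ltr_sum => [|y yb].
      by case: (bins) bins0 => // y t _; rewrite /= mem_head.
    by rewrite ltNge; apply/negP => le; apply: h; exists y.
  apply/negP; rewrite -leNgt (le_trans _ sumle)//.
  have <- : wsum s a (c @^-1` setT) = \sum_(y <- bins) wsum s a [set x | c x = y].
    by rewrite (wsum_fibers _ _ ubins)//; apply: eq_bigl => y; rewrite in_setT.
  by rewrite preimage_setT wsum_setT lerDr.
exists (fun x => if x == z then y0 else c x); split=> [x|y eps ybins eps0 ale].
  by case: ifP.
have wE : wsum s a [set x | (if x == z then y0 else c x) = y] =
          wsum s a [set x | c x = y].
  apply: eq_wsum => x xs /=.
  by rewrite (_ : x == z = false)//; apply: contraNF zs => /eqP <-.
rewrite {1}/wsum big_cons -/(wsum _ _ _) wE; case: ifPn.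
  rewrite inE/= eqxx => <-; rewrite addrC lerD// ale// mem_head//.
by move=> _; apply: cle => // x xs; apply: ale; rewrite in_cons xs orbT.
Qed.

End assignments.

Section block_systems.
Variable R : realType.
Implicit Types (e : nat -> seq nat) (w : nat -> nat -> R).

(** The working form of [density_ideal]: [e n] will list the support of the [n]-th measure and [w n]
    its point masses. *)
Definition density e w : set_system nat :=
  [set X | wsum (e n) (w n) X @[n --> \oo] --> 0].

Definition block_system e w : Prop :=
  [/\ forall n, uniq (e n), forall n m x, x \in e n -> x \in e m -> n = m &
      forall n x, 0 <= w n x].

Definition bounded_blocks e w : Prop :=
  exists M : R, forall n, wsum (e n) (w n) setT <= M.

Definition vanishing_atoms e w : Prop :=
  forall eps : R, 0 < eps -> exists N, forall n, (N <= n)%N ->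
    forall x, x \in e n -> w n x <= eps.

Lemma densityP e w X : block_system e w -> density e w X <->
  forall eps : R, 0 < eps -> exists N, forall n, (N <= n)%N ->
    wsum (e n) (w n) X <= eps.
Proof. by move=> [_ _ w0]; apply: nonneg_cvg0P => n; exact: wsum_ge0. Qed.

(** Disjointness of the blocks merges choices made block by block into one function. *)
Lemma block_glue (T : Type) (t0 : T) e w (c : nat -> nat -> T) : block_system e w ->
  exists f : nat -> T, forall n x, x \in e n -> f x = c n x.
Proof.
move=> [_ disj _]; have /choice[b bE] : forall x, exists n, forall m, x \in e m -> m = n.
  move=> x; have [[n xn]|nx] := pselect (exists n, x \in e n).
    by exists n => m xm; exact: (disj m n x).
  by exists 0%N => m xm; exfalso; apply: nx; exists m.
by exists (fun x => c (b x) x) => n x /bE <-.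
Qed.

Lemma density_small_colorings e w : block_system e w -> bounded_blocks e w ->
  vanishing_atoms e w -> has_small_colorings (density e w) (density e w).
Proof.
move=> sys [M0 hM0] atoms; have [ue disj w0] := sys.
pose M := Num.max M0 0.
have M_ge0 : 0 <= M by rewrite le_max lexx orbT.
have hM n : wsum (e n) (w n) setT <= M by rewrite le_max hM0.
(* On block [n], the colouring [C (j, n)] has [j.+1] classes of equal capacity [M / j.+1%:R]. *)
have /choice[C CP] : forall jn : nat * nat, exists c : nat -> nat,
    (forall x, (c x < jn.1.+1)%N) /\ forall i (eps : R), (i < jn.1.+1)%N -> 0 <= eps ->
      (forall x, x \in e jn.2 -> w jn.2 x <= eps) ->
      wsum (e jn.2) (w jn.2) [set x | c x = i] <= M / jn.1.+1%:R + eps.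
  move=> [j n] /=.
  have [|||c [cb cle]] := @greedy_assignment _ (w n) (e n) (iota 0 j.+1)
      (fun=> M / j.+1%:R) (w0 n) (ue n) (iota_uniq _ _).
  - by [].
  - by move=> _; rewrite divr_ge0.
  - rewrite big_const_seq count_predT size_iota iter_addr_0.
    by rewrite -[leRHS]mulr_natr divfK ?pnatr_eq0// -wsum_setT.
  by exists c; split=> [x|i eps ij]; [have := cb x; rewrite mem_iota|
    apply: cle; rewrite mem_iota].
have /choice[c cE] : forall j, exists f : nat -> nat, (forall x, (f x < j.+1)%N) /\
    forall n x, x \in e n -> f x = C (j, n) x.
  move=> j; have [f fE] := block_glue 0%N (fun n => C (j, n)) sys.
  exists (fun x => if (f x < j.+1)%N then f x else 0%N); split=> [x|n x xn].
    by case: ifP.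
  by rewrite (fE _ _ xn); have [/(_ x) -> _] := CP (j, n).
exists c; split; first by move=> j; exists j.+1; have [] := cE j.
move=> p A hA; apply/(densityP _ sys) => eps eps0.
(* The bound [eps] is split into three: the capacity of a class of [c j], the overflow by one atom,
   and the exceptional part of [A]. *)
pose j := Num.trunc (M / (eps / 3)).
have e3 : 0 < eps / 3 by rewrite divr_gt0.
have jP : M / j.+1%:R <= eps / 3.
  have : M / (eps / 3) <= j.+1%:R by exact: ltW (truncnS_gt _).
  by rewrite !ler_pdivrMr// mulrC.
have [N1 h1] := (densityP _ sys).1 (hA j) _ e3.
have [N2 h2] := atoms _ e3.
exists (maxn N1 N2) => n; rewrite geq_max => /andP[/h1 {}h1 /h2 {}h2].
rewrite (wsum_setID _ _ A [set x | c j x != p j]).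
have : wsum (e n) (w n) (A `\` [set x | c j x != p j]) <= M / j.+1%:R + eps / 3.
  have [pj|pj] := ltnP (p j) j.+1.
    have [_ /(_ (p j) (eps / 3) pj (ltW e3) h2)] := CP (j, n).
    apply: le_trans; apply: le_wsum_in => // x xn [_ /= /negP]; rewrite negbK.
    by have [_ <-//] := cE j; move/eqP.
  (* Here [p j] is not a colour of [c j], so its class is empty. *)
  rewrite wsum_eq0 => [|x xn [_ /=]]; first by rewrite addr_ge0 ?(ltW e3)// divr_ge0.
  apply.
  by have [/(_ x) cx _] := cE j; apply: contraTneq pj => <-; rewrite -ltnNge.
move=> h; apply: le_trans (lerD h1 (le_trans h (lerD jP (lexx _)))) _.
by lra.
Qed.
End block_systems.

(** Diagonalisation: if [T j] is a threshold for [P j], then [r k] is the largest [j <= k] with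
    [T j <= k]. It tends to infinity slowly enough for [P (r k) k] to hold eventually. *)
Lemma slow_index (P : nat -> nat -> Prop) :
  (forall j, exists K, forall k, (K <= k)%N -> P j k) ->
  exists r : nat -> nat, forall j, exists K, forall k, (K <= k)%N ->
    (j <= r k)%N /\ P (r k) k.
Proof.
move=> /choice[T PT].
have /choice[r rP] : forall k, exists r, (T 0%N <= k)%N ->
    (T r <= k)%N /\ forall j, (j <= k)%N -> (T j <= k)%N -> (j <= r)%N.
  move=> k; have [T0k|_] := boolP (T 0%N <= k)%N; last by exists 0%N.
  have exP : exists j, (fun j => (j <= k) && (T j <= k))%N j by exists 0%N.
  have ubP j : (fun j => (j <= k) && (T j <= k))%N j -> (j <= k)%N by case/andP.
  exists (ex_maxn exP ubP) => _; case: ex_maxnP => i /andP[_ Ti] imax.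
  by split=> // j jk Tj; apply: imax; rewrite jk.
exists r => j; exists (maxn (T 0%N) (maxn j (T j))) => k.
rewrite !geq_max => /and3P[T0k jk Tjk]; have [Trk rmax] := rP k T0k.
by split; [exact: rmax|exact: PT].
Qed.

(** * Katetov reductions and unbounded vanishing measures *)

Section katetov_and_unbounded_measures.
Variable R : realType.
Implicit Types (e : nat -> seq nat) (w : nat -> nat -> R).

Lemma density_properP e w : block_system e w -> ~ density e w setT ->
  exists2 d : R, 0 < d & exists l : nat -> nat,
    forall j, (j <= l j)%N /\ d < wsum (e (l j)) (w (l j)) setT.
Proof.
move=> sys; rewrite densityP// => h.
have [d d0 hd] : exists2 d : R, 0 < d &
    forall N, exists n, (N <= n)%N /\ d < wsum (e n) (w n) setT.
  apply: contrapT => h'; apply: h => d d0; apply: contrapT => hN; apply: h'.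
  exists d => // N; apply: contrapT => h''; apply: hN; exists N => n Nn.
  by rewrite leNgt; apply/negP => ?; apply: h''; exists n.
by have /choice[l lP] := hd; exists d => //; exists l.
Qed.

(** Block [k] of the second system is distributed over the points of the heavy block [l (r k)] of
    the first, with capacities proportional to [w]. The preimage of [A] then has mass at most
    [M / d] times that of [A] in the heavy block, plus the overflow. *)
Lemma density_katetov e w e' w' : block_system e w -> block_system e' w' ->
  ~ density e w setT -> bounded_blocks e' w' -> vanishing_atoms e' w' ->
  katetov_le (density e w) (density e' w').
Proof.
move=> sys sys' nT [M0 hM0] atoms.
have [d d0 [l lP]] := density_properP sys nT.
have [ue _ w0] := sys; have [ue' _ w'0] := sys'.
pose M := Num.max M0 0.
have M_ge0 : 0 <= M by rewrite le_max lexx orbT.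
have hM n : wsum (e' n) (w' n) setT <= M by rewrite le_max hM0.
(* Each bin overflows by at most one atom, so if the atoms are below [eta j], the total overflow is
   at most [j.+1%:R^-1]. *)
pose eta j : R := j.+1%:R^-1 / (size (e (l j))).+1%:R.
have eta0 j : 0 < eta j by rewrite divr_gt0.
have [r rP] := @slow_index (fun j k => forall x, x \in e' k -> w' k x <= eta j)
  (fun j => atoms _ (eta0 j)).
(* Heavy blocks have mass above [d], so the factor [M / d] raises the total capacity to at least
   [M]. *)
pose q k y := M / d * w (l (r k)) y.
have /choice[C CP] : forall k, exists c : nat -> nat,
    (forall x, c x \in e (l (r k))) /\
    forall y (eps : R), y \in e (l (r k)) -> 0 <= eps ->
      (forall x, x \in e' k -> w' k x <= eps) ->
      wsum (e' k) (w' k) [set x | c x = y] <= q k y + eps.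
  move=> k; apply: greedy_assignment => //.
  - have [_] := lP (r k); case: (e (l (r k))) => //.
    by rewrite /wsum big_nil => /(lt_trans d0); rewrite ltxx.
  - by move=> y; rewrite mulr_ge0// divr_ge0// ltW.
  - rewrite -wsum_setT (le_trans (hM k))// -mulr_sumr -mulrA ler_peMr//.
    rewrite mulrC ler_pdivlMr// mul1r -wsum_setT ltW//.
    by have [] := lP (r k).
have [f fE] := block_glue 0%N C sys'.
exists f => A /(densityP _ sys) hA; apply/(densityP _ sys') => eps eps0.
pose eps' := eps / 2 / (M / d + 1).
have Md : 0 < M / d + 1 by rewrite ltr_wpDl// divr_ge0// ltW.
have eps'0 : 0 < eps' by rewrite !divr_gt0.
have [N hN] := hA _ eps'0.
pose J := Num.trunc (eps / 2)^-1.
have JP : J.+1%:R^-1 < eps / 2.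
  by rewrite invf_plt ?posrE ?divr_gt0// truncnS_gt.
have [K hK] := rP (maxn N J); exists K => k /hK[].
rewrite geq_max => /andP[Nr Jr] atomk.
have [CB Cle] := CP k; set B := e (l (r k)) in CB Cle.
rewrite (@eq_wsum _ _ _ _ (C k @^-1` A)); last first.
  by move=> x xk; rewrite /preimage /= (fE _ _ xk).
rewrite (wsum_fibers _ _ (ue (l (r k)))) -/B//.
apply: (@le_trans _ _ (\sum_(y <- B | y \in A) (q k y + eta (r k)))).
  rewrite big_seq_cond [leRHS]big_seq_cond; apply: ler_sum => y /andP[yB _].
  by apply: Cle => //; exact: ltW.
rewrite big_split/= -mulr_sumr -/(wsum B (w (l (r k))) A) [eps]splitr lerD//.
  apply: (@le_trans _ _ (M / d * eps')).
    apply: ler_wpM2l; first by rewrite divr_ge0// ltW.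
    by apply: hN; have [+ _] := lP (r k); exact: leq_trans.
  rewrite /eps' mulrCA ler_piMr ?divr_ge0 ?(ltW eps0)//.
  by rewrite ler_pdivrMr// mul1r lerDl.
apply: (@le_trans _ _ (\sum_(y <- B) eta (r k))).
  by rewrite big_mkcond; apply: ler_sum => y _; case: ifP => // _; exact: ltW.
rewrite big_const_seq count_predT iter_addr_0 -[leLHS]mulr_natr.
apply: le_trans (ltW JP); rewrite /eta -/B -mulrA.
apply: (@le_trans _ _ (r k).+1%:R^-1).
  by rewrite ler_piMr// mulrC ler_pdivrMr// mul1r ler_nat.
by rewrite lef_pV2 ?posrE// ler_nat.
Qed.

Definition unbounded_vanishing (I : set_system nat) : Prop :=
  exists (s : nat -> seq nat) (v : nat -> nat -> R),
    [/\ forall k, uniq (s k), forall k x, 0 <= v k x,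
        forall M, exists k, M <= wsum (s k) (v k) setT &
        forall A, I A -> wsum (s k) (v k) A @[k --> \oo] --> 0].

(** If the masses are unbounded, the blocks themselves serve. Otherwise infinitely many blocks have
    an atom above some [eps], and a set of the ideal eventually misses these atoms, so they may be
    given arbitrarily large weights. *)
Lemma not_bounded_unbounded_vanishing e w : block_system e w ->
  ~ (bounded_blocks e w /\ vanishing_atoms e w) ->
  unbounded_vanishing (density e w).
Proof.
move=> sys /not_andP; have [ue _ w0] := sys; case=> [nb|na].
  exists e, w; split=> // M; apply: contrapT => h; apply: nb; exists M => n.
  by rewrite leNgt; apply/negP => /ltW lt; apply: h; exists n.
have [eps eps0 heps] : exists2 eps : R, 0 < eps &
    forall N, exists n, (N <= n)%N /\ exists2 x, x \in e n & eps < w n x.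
  apply: contrapT => h; apply: na => eps eps0; apply: contrapT => hN; apply: h.
  exists eps => // N; apply: contrapT => h'; apply: hN; exists N => n Nn x xn.
  by rewrite leNgt; apply/negP => ?; apply: h'; exists n; split=> //; exists x.
have /choice[s sP] : forall n, exists t : seq nat,
    (exists x, [/\ t = [:: x], x \in e n & eps < w n x]) \/
    (t = [::] /\ ~ exists2 x, x \in e n & eps < w n x).
  move=> n; have [[x xn xe]|nx] := pselect (exists2 x, x \in e n & eps < w n x).
    by exists [:: x]; left; exists x.
  by exists [::]; right.
(* Weight [n] on the heavy atom of block [n], and the zero measure if block [n] has none. *)
exists s, (fun n _ => n%:R); split=> [k|//|M|A].
- by case: (sP k) => [[x [-> _ _]]|[-> _]].
- have [n [Mn xn]] := heps (Num.trunc M).+1; exists n; rewrite wsum_setT.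
  case: (sP n) => [[x [-> _ _]]|[_ /(_ xn)//]]; rewrite big_seq1.
  by rewrite (le_trans (ltW (truncnS_gt M)))// ler_nat.
- move=> /(densityP _ sys)/(_ _ eps0)[N hN].
  apply/nonneg_cvg0P => [n|eps' eps'0]; first exact: wsum_ge0.
  exists N => n Nn; rewrite wsum_eq0 ?ltW// => y ys Ay.
  case: (sP n) => [[x [sx xn xe]]|[sx _]]; move: ys; rewrite sx ?in_nil// inE => /eqP yx.
  have Ax : A x by rewrite -yx.
  by have := le_trans (wsum_ge_mem (w0 n) xn Ax) (hN _ Nn); rewrite leNgt xe.
Qed.

(** Adding the measures index by index to the block measures keeps the ideal, since they vanish in
    the limit on it, but makes the supremum infinite on [setT]. *)
Lemma unbounded_vanishing_not_tb e w : block_system e w ->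
  is_ideal (density e w) -> unbounded_vanishing (density e w) ->
  ~ totally_bounded_ideal R (density e w).
Proof.
move=> sys idI [s [v [_ v0 unb van]]] tb; have [_ _ w0] := sys.
pose th n A := wsum (e n) (w n) A + wsum (s n) (v n) A.
have th0 n : th n set0 = 0 by rewrite /th !wsum_set0 addr0.
have th_mono n A B : A `<=` B -> th n A <= th n B.
  by move=> AB; apply: lerD; exact: le_wsum.
have th_subadd n A B : th n (A `|` B) <= th n A + th n B.
  by rewrite /th addrACA; apply: lerD; exact: wsumU_le.
have th_tail n : exists N, forall m A, (N <= m)%N -> th n (A `\` `I_m) = 0.
  have [N1 h1] := wsum_tail_eq0 (e n) (w n).
  have [N2 h2] := wsum_tail_eq0 (s n) (v n).
  exists (maxn N1 N2) => m A; rewrite geq_max => /andP[N1m N2m].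
  by rewrite /th h1// h2// addr0.
have th_vanish A : density e w A -> th n A @[n --> \oo] --> 0.
  by move=> IA; rewrite -[0]addr0; apply: cvgD => //; exact: van.
have th_pt x : th n [set x] @[n --> \oo] --> 0.
  exact/th_vanish/(ideal_finite idI).
have IE : density e w = Exh (sup_submeasure th).
  rewrite Exh_sup_submeasure//; apply/seteqP; split=> A /=.
    exact: th_vanish.
  have th_ge0 n : 0 <= th n A by rewrite -(th0 n) th_mono.
  move=> /nonneg_cvg0P-/(_ th_ge0) h; apply/(densityP _ sys) => eps /h[N hN].
  by exists N => n /hN; apply: le_trans; rewrite lerDl wsum_ge0.
have := tb _ (sup_submeasureP th0 th_mono th_subadd th_pt)
  (sup_submeasure_lsc th0 th_mono th_subadd th_tail th_pt) IE.
rewrite sup_submeasure_setT_oo// => M; have [n Mn] := unb M; exists n.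
by rewrite (le_trans Mn)// lerDr wsum_ge0.
Qed.

End katetov_and_unbounded_measures.

Lemma density_finite (R : realType) e (w : nat -> nat -> R) A :
  block_system e w -> finite_set A -> density e w A.
Proof.
move=> sys /finite_seqP[s ->]; have [_ disj w0] := sys.
have [N hN] : exists N, forall n x, (N <= n)%N -> x \in e n -> x \notin s.
  elim: s => [|y s [N hN]]; first by exists 0%N.
  have [[m ym]|ny] := pselect (exists m, y \in e m).
    exists (maxn N m.+1) => n x; rewrite geq_max => /andP[Nn mn] xn.
    rewrite in_cons (negbTE (hN n x Nn xn)) orbF; apply/eqP => xy.
    by move: mn; rewrite (disj m n y) ?ltnn// -xy.
  exists N => n x Nn xn; rewrite in_cons (negbTE (hN n x Nn xn)) orbF.
  by apply/eqP => xy; apply: ny; exists n; rewrite -xy.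
apply/(densityP _ sys) => eps eps0; exists N => n Nn.
by rewrite wsum_eq0 ?ltW// => x /(hN n x Nn)/negP.
Qed.

(** * The Nikodym property *)

Section N_space_clopen.
Variables (I : set_system nat) (idI : is_ideal I).
Implicit Types U : set (N_space (dual_filter I)).

Let FF : Filter (dual_filter I).
Proof. by have [[]] := idI. Qed.

Lemma N_space_openP U : open U <->
  (U None -> I (~` (Some @^-1` U))).
Proof.
have FFi := FF; rewrite openE; split=> [oU UN|hU].
  have [A FA AU] := (@N_space_nbhs_None _ FF U).1 (oU _ UN).
  apply/dual_filterC; rewrite setCK; apply: filterS FA => n An /=.
  by apply: AU; right; exists n.
move=> [n|] Ux; first exact/N_space_nbhs_Some.
apply/(@N_space_nbhs_None _ FF); exists (Some @^-1` U).
  by rewrite -[X in dual_filter I X]setCK; apply/dual_filterC/hU.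
by move=> _ [->//|[n Un <-]].
Qed.

Lemma N_space_clopenP U : ~ U None -> clopen U <-> I (Some @^-1` U).
Proof.
move=> UN; split=> [[_ /closed_openC/N_space_openP/(_ UN)]|IU].
  by rewrite preimage_setC setCK.
split; first by apply/N_space_openP.
rewrite -[U]setCK; apply: open_closedC; apply/N_space_openP => _.
by rewrite preimage_setC setCK.
Qed.

End N_space_clopen.

Lemma fsum_N_space (R : realType) (F : set_system nat) (a : N_space F -> R)
    (s : seq nat) (U : set (N_space F)) : uniq s ->
  (forall n, n \notin s -> a (Some n) = 0) ->
  \sum_(x \in U) a x =
    (if None \in U then a None else 0) + wsum s (a \o Some) (Some @^-1` U).
Proof.
move=> us as0; have [t tE] : exists t : seq (N_space F), t = None :: map Some s by eexists.
have ut : uniq t.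
  rewrite tE /= map_inj_uniq ?us ?andbT; last by move=> ? ? [].
  by apply/mapP => -[].
rewrite (fsbigE [seq x <- t | x \in U]) ?filter_uniq//; last 2 first.
- by move=> x /=; rewrite mem_filter => /andP[/set_mem].
- move=> [n|] Ux; rewrite mem_filter (mem_set Ux) /= => nt.
    2: by move: nt; rewrite tE mem_head.
  apply: as0; apply: contra nt => ns; rewrite tE in_cons /=.
  exact: map_f.
rewrite big_filter_cond (eq_bigl (mem U)) => [|x]; last exact: andbb.
rewrite tE big_cons big_map.
have -> : wsum s (a \o Some) (Some @^-1` U) =
    \sum_(j <- s | (Some j : N_space F) \in U) a (Some j).
  by apply: eq_bigl => j; apply/idP/idP; rewrite !inE.
by rewrite /=; case: ifP => _; rewrite ?add0r.
Qed.

(** * Signed sums and Schur's theorem *)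

Section schur.
Variable R : realType.

Lemma cvg0P (u : nat -> R) : (u n @[n --> \oo] --> 0) <->
  (forall e : R, 0 < e -> exists N, forall n, (N <= n)%N -> `|u n| <= e).
Proof.
split=> [/cvgr0Pnorm_le h e /h[N _ hN]|h]; first by exists N => n /hN.
by apply/cvgr0Pnorm_le => e /h[N hN]; exists N => // n /hN.
Qed.

Implicit Types (s : seq nat) (a : nat -> R).

Lemma ler_norm_wsum s a X : `|wsum s a X| <= wsum s (fun x => `|a x|) X.
Proof. exact: ler_norm_sum. Qed.

Lemma wsum_norm_set1 s a x : uniq s ->
  wsum s (fun x => `|a x|) [set x] = `|wsum s a [set x]|.
Proof.
move=> us; rewrite /wsum -big_filter -[in RHS]big_filter.
have -> : [seq y <- s | y \in [set x]] = if x \in s then [:: x] else [::].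
  case: ifPn => xs.
    by rewrite -(filter_pred1_uniq us xs); apply: eq_filter => y; rewrite in_set1.
  apply/eqP; rewrite -size_eq0 size_filter -leqn0 leqNgt -has_count.
  by apply: contra xs => /hasP[y ys]; rewrite in_set1 => /eqP <-.
by case: ifP => _; rewrite ?big_seq1// !big_nil normr0.
Qed.

(** Split [X] by the sign of [a]: one of the two parts carries at least half of the total
    variation. *)
Lemma wsum_norm_half s a X : exists2 Y, Y `<=` X &
  wsum s (fun x => `|a x|) X <= 2 * `|wsum s a Y|.
Proof.
pose P := [set x | 0 <= a x].
have hP : wsum s (fun x => `|a x|) (X `&` P) = `|wsum s a (X `&` P)|.
  rewrite ger0_norm; last by apply: sumr_ge0 => x; rewrite inE => -[].
  by apply: eq_bigr => x; rewrite inE => -[_ Px]; rewrite ger0_norm.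
have hN : wsum s (fun x => `|a x|) (X `\` P) = `|wsum s a (X `\` P)|.
  have neg x : x \in X `\` P -> a x <= 0.
    by rewrite inE => -[_ /negP]; rewrite -ltNge => /ltW.
  rewrite ler0_norm; last exact: sumr_le0.
  by rewrite -sumrN; apply: eq_bigr => x /neg; exact: ler0_norm.
have := wsum_setID s (fun x => `|a x|) X P; rewrite hP hN => ->.
have [PN|NP] := leP `|wsum s a (X `\` P)| `|wsum s a (X `&` P)|.
  by exists (X `&` P); [exact: subIsetl|lra].
by exists (X `\` P); [exact: subDsetl|lra].
Qed.

(* The gliding hump argument behind Schur's theorem on l^1. *)
Lemma schur_gliding_hump (s : nat -> seq nat) (a : nat -> nat -> R) A :
  (forall k, uniq (s k)) ->
  (forall B, B `<=` A -> wsum (s k) (a k) B @[k --> \oo] --> 0) ->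
  wsum (s k) (fun x => `|a k x|) A @[k --> \oo] --> 0.
Proof.
move=> us aB; pose b k x := `|a k x|.
have b0 k x : 0 <= b k x by exact: normr_ge0.
have wb0 k X : 0 <= wsum (s k) (b k) X by exact: wsum_ge0.
(* Applying the hypothesis to singletons shows that the total variation on a finite initial segment
   tends to 0. *)
have initial m : forall e : R, 0 < e -> exists N, forall k, (N <= k)%N ->
    wsum (s k) (b k) (A `&` `I_m) <= e.
  elim: m => [|m ih] e e0.
    by exists 0%N => k _; rewrite II0 setI0 wsum_set0 ltW.
  have [|N hN] := ih (e / 2); first by rewrite divr_gt0.
  have [Am|nAm] := pselect (A m); last first.
    exists N => k /hN; rewrite (_ : A `&` `I_m.+1 = A `&` `I_m); first by lra.
    apply/seteqP; split=> x [Ax /= xm]; split=> //=; last exact: ltnW.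
    by move: xm; rewrite ltnS leq_eqVlt => /orP[/eqP xm|//]; rewrite -xm in nAm.
  have [||M hM] := (cvg0P _).1 (aB [set m] _) (e / 2).
  - by move=> _ ->.
  - by rewrite divr_gt0.
  exists (maxn N M) => k; rewrite geq_max => /andP[/hN h1 /hM h2].
  apply: le_trans (le_trans (wsumU_le _ (A `&` `I_m) [set m] (b0 k)) _).
    apply: le_wsum => // x [Ax]; rewrite IIS => -[xm|]; [by left|by right].
  by rewrite wsum_norm_set1//; lra.
apply/nonneg_cvg0P => // e e0; apply: contrapT => nN.
have big N : exists k, (N <= k)%N /\ e < wsum (s k) (b k) A.
  apply: contrapT => h; apply: nN; exists N => k Nk.
  by rewrite leNgt; apply/negP => lt; apply: h; exists k.
have e8 : 0 < e / 8 by rewrite divr_gt0.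
(* Given [m], choose an index [k] with variation above [e] on [A] but at most [e / 8] below [m], and
   a bound [m'] beyond the support. More than [7 * e / 8] is left on [[m, m')], and one sign carries
   half of it, hence at least [3 * e / 8]. *)
have /choice[F FP] : forall m, exists kmY : nat * nat * set nat,
    [/\ (m <= kmY.1.1)%N, (m < kmY.1.2)%N,
        kmY.2 `<=` A `&` [set x | m <= x < kmY.1.2]%N,
        wsum (s kmY.1.1) (b kmY.1.1) (A `&` `I_m) <= e / 8 /\
        (forall X, wsum (s kmY.1.1) (b kmY.1.1) (X `\` `I_(kmY.1.2)) = 0) &
        3 * e / 8 <= `|wsum (s kmY.1.1) (a kmY.1.1) kmY.2| ].
  move=> m; have [N hN] := initial m _ e8; have [k []] := big (maxn N m).
  rewrite geq_max => /andP[/hN {}hN mk] ek.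
  have [T hT] := wsum_tail_eq0 (s k) (b k).
  pose m' := maxn T m.+1.
  have [Y YX hY] := wsum_norm_half (s k) (a k) ((A `\` `I_m) `&` `I_m').
  exists (k, m', Y); split=> //=; first by rewrite leq_maxr.
  - move=> x /YX[[Ax /= /negP]]; rewrite -leqNgt => mx xm'; split=> //=.
    by rewrite mx.
  - by split=> // X; apply: hT; rewrite leq_maxl.
  - have := wsum_setID (s k) (b k) A `I_m.
    have := wsum_setID (s k) (b k) (A `\` `I_m) `I_m'.
    rewrite [X in _ = _ + X](hT m' _ (leq_maxl _ _)).
    by move: hY; rewrite -/(b k); lra.
(* The cut points: the [i]-th hump lies in [[m i, m i.+1)]. *)
pose m := fix m i := if i is i'.+1 then (F (m i')).1.2 else 0%N.
have m_lt i : (m i < m i.+1)%N by have [] := FP (m i).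
have m_homo i j : (i <= j)%N -> (m i <= m j)%N.
  elim: j => [|j ih]; first by rewrite leqn0 => /eqP->.
  rewrite leq_eqVlt => /orP[/eqP->//|]; rewrite ltnS => /ih h.
  exact: leq_trans h (ltnW (m_lt j)).
have m_ge i : (i <= m i)%N.
  by elim: i => // i ih; exact: leq_ltn_trans ih (m_lt i).
pose B := \bigcup_i (F (m i)).2.
have BA : B `<=` A by move=> x [i _]; have [_ _ YA _ _] := FP (m i); move=> /YA[].
have [N hN] := (cvg0P _).1 (aB B BA) _ e8.
have [mk _ YA [small tail] large] := FP (m N).
have := hN (F (m N)).1.1 (leq_trans (m_ge N) mk).
set k := (F (m N)).1.1 in mk small tail large *.
have := wsum_setID (s k) (a k) B `I_(m N).
have := wsum_setID (s k) (a k) (B `\` `I_(m N)) `I_(m N.+1).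
have -> : (B `\` `I_(m N)) `&` `I_(m N.+1) = (F (m N)).2.
  apply/seteqP; split=> [x [[[i _ Yx] /= /negP]]|x Yx].
    rewrite -leqNgt => mNx xmN; have [_ _ /(_ _ Yx)[_ /= /andP[mx xm]] _ _] := FP (m i).
    have [iN|Ni|<-//] := ltngtP i N.
      by move: (leq_trans xm (m_homo i.+1 N iN)); rewrite ltnNge mNx.
    by move: (leq_trans xmN (m_homo N.+1 i Ni)); rewrite ltnNge mx.
  have [_ /= /andP[mx xm]] := YA _ Yx; split=> //; split; first by exists N.
  by apply/negP; rewrite -leqNgt.
have z : wsum (s k) (a k) (B `\` `I_(m N) `\` `I_(m N.+1)) = 0.
  by apply/eqP; rewrite -normr_le0 (le_trans (ler_norm_wsum _ _ _))// tail.
rewrite z addr0 => ->.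
have h1 : `|wsum (s k) (a k) (B `&` `I_(m N))| <= e / 8.
  apply: le_trans small; apply: le_trans (ler_norm_wsum _ _ _) _.
  by apply: le_wsum => //; exact: setSI.
move=> ->; rewrite leNgt => /negP; apply.
(* On [B] the sum is at least [3 * e / 8 - e / 8] in absolute value, against the bound [e / 8] from
   [hN]. *)
have := ler_normD (- wsum (s k) (a k) (B `&` `I_(m N)))
  (wsum (s k) (a k) (B `&` `I_(m N)) + wsum (s k) (a k) (F (m N)).2).
by rewrite addKr normrN; move: large h1; lra.
Qed.

End schur.

Section nikodym.
Variables (R : realType) (I : set_system nat).
Hypothesis idI : is_ideal I.

(** The mass [- T j] at the limit point makes the total 0. A clopen set, or else its complement,
    avoids that point and so corresponds to a set of [I]. *)
Lemma unbounded_vanishing_not_Nikodym :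
  unbounded_vanishing R I -> ~ Nikodym_filter R (dual_filter I).
Proof.
move=> [s [v [us v0 unb van]]]; apply.
have /choice[k kP] : forall j, exists k, (j <= k)%N /\
    j%:R <= wsum (s k) (v k) setT.
  (* Unbounded masses need not diverge, so a subsequence is chosen. Asking for more than all masses
     of index below [j] together forces [j <= k]. *)
  move=> j; have [k] := unb (j%:R + \sum_(i < j) wsum (s i) (v i) setT + 1).
  have sum_ge0 (P : pred 'I_j) : 0 <= \sum_(i < j | P i) wsum (s i) (v i) setT.
    by apply: sumr_ge0 => i _; exact: wsum_ge0.
  move=> hk; exists k; split; last first.
    by apply: le_trans hk; rewrite -addrA lerDl addr_ge0.
  rewrite leqNgt; apply/negP => kj; move: hk; rewrite (bigD1 (Ordinal kj))//=.
  have := sum_ge0 (fun i => i != Ordinal kj); have : 0 <= j%:R :> R by [].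
  by lra.
pose T j := wsum (s (k j)) (v (k j)) setT.
have T_ge0 j : 0 <= T j by exact: wsum_ge0.
pose a j (x : N_space (dual_filter I)) : R :=
  if x is Some n then if n \in s (k j) then v (k j) n else 0 else - T j.
have a0 j n : n \notin s (k j) -> a j (Some n) = 0 by move=> /= /negbTE ->.
have aE j X : wsum (s (k j)) (a j \o Some) X = wsum (s (k j)) (v (k j)) X.
  by rewrite /wsum big_seq_cond [RHS]big_seq_cond; apply: eq_bigr => n /andP[/= ->].
have van' A : I A -> wsum (s (k j)) (v (k j)) A @[j --> \oo] --> 0.
  move=> /van/nonneg_cvg0P h; apply/nonneg_cvg0P => [j|e e0]; first exact: wsum_ge0.
  have [n|N hN] := h _ e e0; first exact: wsum_ge0.
  by exists N => j Nj; apply: hN; apply: leq_trans Nj _; have [] := kP j.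
exists a; split=> [j||U cU].
- apply: (@sub_finite_set _ _ (None |` Some @` [set` s (k j)])); last first.
    by rewrite finite_setU; split=> //; apply: finite_image.
  move=> [n|] /= an; last by left.
  by right; exists n => //=; move: an; case: ifP => //; rewrite eqxx.
- apply/cvgryPge => M; exists (Num.trunc M).+1 => // j /= Mj.
  rewrite (fsum_N_space _ (us (k j))) => [|n /a0 ->]; last by rewrite normr0.
  rewrite mem_set//= normrN ger0_norm//.
  apply: (@le_trans _ _ (T j)); last first.
    by rewrite lerDl; apply: wsum_ge0 => x; exact: normr_ge0.
  have [_] := kP j; apply: le_trans; apply: le_trans (ltW (truncnS_gt M)) _.
  by rewrite ler_nat.
- have -> : (fun j => \sum_(x \in U) a j x) = fun j =>
      (if None \in U then - T j else 0) + wsum (s (k j)) (v (k j)) (Some @^-1` U).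
    by apply/funext => j; rewrite (fsum_N_space _ (us (k j)) (a0 j)) aE.
  have [UN|UN] := pselect (U None).
    have nUN : ~ (~` U) None by apply.
    have /(N_space_clopenP idI nUN) IU : clopen (~` U) by exact: (clopenC U).
    have -> : (fun j => (if None \in U then - T j else 0) +
        wsum (s (k j)) (v (k j)) (Some @^-1` U)) =
      fun j => - wsum (s (k j)) (v (k j)) (Some @^-1` (~` U)).
      apply/funext => j; rewrite mem_set// /T (wsum_setID _ _ setT (Some @^-1` U)).
      by rewrite setTI setTD preimage_setC; lra.
    by rewrite -[0]oppr0; apply: cvgN; exact: van'.
  have -> : (fun j => (if None \in U then - T j else 0) +
        wsum (s (k j)) (v (k j)) (Some @^-1` U)) =
      fun j => wsum (s (k j)) (v (k j)) (Some @^-1` U).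
    by apply/funext => j; rewrite memNset// add0r.
  by apply/van'/(N_space_clopenP idI UN).
Qed.

(** The witnesses are the absolute values of the coefficients on [nat]. Every subset of a set of [I]
    gives a clopen set, so the gliding hump argument applies. *)
Lemma not_Nikodym_unbounded_vanishing :
  ~ Nikodym_filter R (dual_filter I) -> unbounded_vanishing R I.
Proof.
move=> /contrapT[a [afin anorm acl]].
have /choice[s sP] : forall k, exists s : seq nat, uniq s /\
    forall n, n \notin s -> a k (Some n) = 0.
  move=> k; have : finite_set (Some @^-1` [set x | a k x != 0]).
    by apply: finite_preimage (afin k) => x y _ _ [].
  move=> /finite_seqP[s sE]; exists (undup s); split=> [|n]; first exact: undup_uniq.
  rewrite mem_undup => ns; apply/eqP/negPn/negP => an.
  by move/negP: ns; apply; have : [set` s] n by rewrite -sE.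
have us k : uniq (s k) by case: (sP k).
have as0 k n : n \notin s k -> a k (Some n) = 0 by case: (sP k) => _; exact.
exists s, (fun k n => `|a k (Some n)|); split=> //.
- move=> M.
  (* Since [setT] is clopen, the coefficient at the limit point eventually differs from [- S] by at
     most 1. The norm is then at most [2 * S' + 1], whence the bound [2 * M + 1]. *)
  have [N1 _ h1] := (cvgryPge _).1 anorm (2 * M + 1).
  have [|N2 h2] := (cvg0P _).1 (acl setT _) 1 ltr01; first exact: clopenT.
  exists (maxn N1 N2).
  have := h1 (maxn N1 N2) (leq_maxl _ _); have := h2 (maxn N1 N2) (leq_maxr _ _).
  set k := maxn N1 N2.
  rewrite (fsum_N_space _ (us k) (as0 k)) /= mem_set//.
  rewrite (fsum_N_space _ (us k)) => [|n /as0 ->]; last by rewrite normr0.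
  rewrite mem_set// preimage_setT.
  set S := wsum _ _ _; set S' := wsum _ _ _; rewrite -/S'.
  have SS' : `|S| <= S' by exact: ler_norm_wsum.
  have := ler_normB (a k None + S) S; rewrite addrK; move: SS'.
  set u := `|_ + S|; move=> h3 h4 h5 h6.
  by change (M <= S'); lra.
- move=> A IA; apply: schur_gliding_hump => // B BA.
  pose U : set (N_space (dual_filter I)) := Some @` B.
  have UE : Some @^-1` U = B.
    by apply/seteqP; split=> [x [y By [<-]]//|x Bx]; exists x.
  have UN : ~ U None by move=> [].
  have cU : clopen U by apply/(N_space_clopenP idI UN); rewrite UE; exact: idealS IA.
  have := acl _ cU.
  have -> : (fun k => \sum_(x \in U) a k x) = fun k => wsum (s k) (a k \o Some) B.
    by apply/funext => k; rewrite (fsum_N_space _ (us k) (as0 k)) memNset// add0r UE.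
  by [].
Qed.

End nikodym.

(** * Erdős–Ulam ideals *)

Section dyadic.
Variable R : realType.

Lemma exp2_unbounded (y : R) : exists K, forall k, (K <= k)%N -> y <= 2 ^+ k.
Proof.
exists (Num.trunc y).+1 => k Kk; rewrite (le_trans (ltW (truncnS_gt y)))//.
by rewrite -natrX ler_nat (leq_trans Kk)// ltnW// ltn_expl.
Qed.

Lemma dyadic_floor (y : R) K : 2 ^+ K <= y ->
  exists2 k, (K <= k)%N & 2 ^+ k <= y < 2 ^+ k.+1.
Proof.
move=> Ky; have exP : exists m, y < 2 ^+ m.
  by have [m /(_ _ (leqnn m))] := exp2_unbounded (y + 1); exists m; lra.
case: (ex_minnP exP) => -[|m] ym mmin.
  move: ym; rewrite expr0 => y1.
  by have := exprn_ege1 K (ler1n R 2); move=> ?; have := le_lt_trans Ky y1; lra.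
exists m; last first.
  by rewrite ym andbT leNgt; apply/negP => /mmin; rewrite ltnn.
rewrite -ltnS -(ltr_eXn2l (x := 2 : R)) ?ltr1n//; exact: le_lt_trans Ky ym.
Qed.

(** A Toeplitz-type average: the first [N] terms contribute a constant [C], which is negligible
    against [2 ^+ k], and the later terms at most a geometric sum times [eps / 4]. *)
Lemma dyadic_average (d : nat -> R) : (forall j, 0 <= d j) ->
  d n @[n --> \oo] --> 0 ->
  forall eps : R, 0 < eps -> exists K, forall k, (K <= k)%N ->
    \sum_(j < k.+1) 2 ^+ j * d j <= eps * 2 ^+ k.
Proof.
move=> d0 /nonneg_cvg0P-/(_ d0) hd eps eps0.
have [|N hN] := hd (eps / 4); first by rewrite divr_gt0.
pose C := \sum_(j < N) 2 ^+ j * d j.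
have h k : (N <= k)%N -> \sum_(j < k) 2 ^+ j * d j <= C + eps / 4 * 2 ^+ k.
  elim: k => [|k ih].
    rewrite leqn0 => /eqP N0; rewrite /C N0 lerDl mulr_ge0 ?divr_ge0 ?(ltW eps0)//.
  rewrite leq_eqVlt => /orP[/eqP <-|].
    by rewrite lerDl mulr_ge0 ?divr_ge0 ?(ltW eps0)// exprn_ge0.
  rewrite ltnS => Nk; rewrite big_ord_recr /= exprS.
  have := ih Nk; have : 2 ^+ k * d k <= 2 ^+ k * (eps / 4).
    by rewrite ler_wpM2l ?hN// exprn_ge0.
  by lra.
have [K hK] := exp2_unbounded (C / (eps / 2)).
exists (maxn N K) => k; rewrite geq_max => /andP[Nk /hK].
rewrite ler_pdivrMr ?divr_gt0// => Ck.
by have := h k.+1 (leqW Nk); rewrite exprS; lra.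
Qed.

End dyadic.

Section wsum_sublists.
Variable R : realType.
Implicit Types (s t : seq nat) (a : nat -> R).

Lemma le_wsum_seq s t a X : (forall x, 0 <= a x) -> uniq s -> uniq t ->
  (forall x, x \in s -> X x -> x \in t) -> wsum s a X <= wsum t a X.
Proof.
move=> a0 us ut st; rewrite [leRHS]/wsum (bigID (mem s))/= ler_wpDr ?sumr_ge0//.
rewrite /wsum -[leLHS]big_filter -[leRHS]big_filter le_eqVlt; apply/orP; left.
apply/eqP; apply: perm_big; apply: uniq_perm; rewrite ?filter_uniq// => x; rewrite !mem_filter.
apply/andP/andP => [[xX xs]|[/andP[-> ->]]//]; rewrite xX xs; split=> //.
by apply: st => //; exact: set_mem.
Qed.

Lemma wsumM s a c X : wsum s (fun x => c * a x) X = c * wsum s a X.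
Proof. by rewrite /wsum mulr_sumr. Qed.

End wsum_sublists.

Section erdos_ulam.
Variables (R : realType) (f : nat -> R).
Hypothesis f0 : forall n, 0 <= f n.

Local Notation F n := (\sum_(0 <= i < n.+1) f i).

Definition partial_sums_unbounded : Prop :=
  forall M, exists N, forall n, (N <= n)%N -> M <= F n.

Lemma partial_sums_unboundedP :
  (\sum_(0 <= i <oo) (f i)%:E = +oo)%E <-> partial_sums_unbounded.
Proof.
have cv : cvgn (fun n => \sum_(0 <= i < n) (f i)%:E)%E.
  by apply: is_cvg_nneseries => n _ _; rewrite lee_fin.
split=> [sumoo M|h].
  move/cvg_ex: cv => [l cvl].
  have loo : l = +oo%E by rewrite -sumoo; apply/esym/cvg_lim.
  move: cvl; rewrite loo => /cvgeyPge/(_ M)[N _ hN].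
  exists N => n Nn; have := hN n.+1 (leqW Nn).
  by rewrite /= sumEFin lee_fin.
apply/cvg_lim => //; apply/cvgeyPge => M; have [N hN] := h M.
exists N.+1 => // -[//|n] /= Nn; rewrite sumEFin lee_fin; exact: hN.
Qed.

Hypothesis F_oo : partial_sums_unbounded.

Let F0 n : 0 <= F n. Proof. exact: sumr_ge0. Qed.

Let F_mono m n : (m <= n)%N -> F m <= F n.
Proof.
by move=> mn; rewrite [leRHS](big_cat_nat (n := m.+1))//= lerDl sumr_ge0.
Qed.

Lemma Exh_EU : Exh (phi_EU f) =
  [set A | wsum (index_iota 0 n.+1) f A / F n @[n --> \oo] --> 0].
Proof.
pose th n A := wsum (index_iota 0 n.+1) f A / F n.
apply: (Exh_sup_submeasure (th := th)).
- by move=> n; rewrite /th wsum_set0 mul0r.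
- by move=> n A B AB; rewrite /th ler_wpM2r ?invr_ge0// le_wsum.
- by move=> n A B; rewrite /th -mulrDl ler_wpM2r ?invr_ge0// wsumU_le.
- move=> n; have [N hN] := wsum_tail_eq0 (index_iota 0 n.+1) f.
  by exists N => m A Nm; rewrite /th hN// mul0r.
- move=> x; apply/nonneg_cvg0P => [n|e e0].
    by rewrite /th divr_ge0// wsum_ge0.
  (* The summand 1 keeps the denominator [F n] positive. *)
  have [N hN] := F_oo (f x / e + 1); exists N => n /hN Fn.
  have fe : 0 <= f x / e by rewrite divr_ge0// ltW.
  rewrite /th ler_pdivrMr; last by lra.
  apply: (@le_trans _ _ (f x)).
    rewrite (le_trans (le_wsum_seq (t := [:: x]) f0 (iota_uniq _ _) _ _))//.
      by move=> y _ ->; rewrite mem_head.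
    by rewrite /wsum big_cons big_nil in_set1 eqxx addr0.
  have -> : f x = e * (f x / e) by rewrite mulrCA divff ?mulr1// gt_eqF.
  by rewrite ler_wpM2l// ?ltW//; lra.
Qed.

(** If [F n < c], then the sum up to [n] is bounded by [F n]; otherwise [n] itself is not
    counted. *)
Lemma wsum_small_partial_sums c n : 0 <= c ->
  wsum (index_iota 0 n) f [set i | F i < c] <= c.
Proof.
move=> c0; elim: n => [|n ih]; first by rewrite /wsum big_nil.
have [Fc|Fc] := ltP (F n) c.
  by apply: le_trans (ltW Fc); rewrite -wsum_setT; exact: le_wsum.
rewrite /wsum big_mkcond big_nat_recr//= -big_mkcond memNset ?addr0//=.
by apply/negP; rewrite -leNgt.
Qed.

Hypothesis f_small : f n / F n @[n --> \oo] --> 0.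

(** The dyadic level sets of [F], weighted by [2 ^- k * f], are bounded blocks with vanishing atoms.
    Their density ideal is contained in the Erdős-Ulam ideal, and this inclusion suffices to
    transfer the colourings. *)
Lemma EU_small_colorings : has_small_colorings (Exh (phi_EU f)) finite_set.
Proof.
have /choice[N hN] : forall k, exists N, forall n, (N <= n)%N -> 2 ^+ k.+1 <= F n.
  by move=> k; exact: F_oo.
pose B k := [set i | 2 ^+ k <= F i < 2 ^+ k.+1].
pose e k := [seq i <- index_iota 0 (N k) | i \in B k].
pose w k x : R := 2 ^- k * f x.
have two_gt0 k : 0 < 2 ^+ k :> R by rewrite exprn_gt0.
have memB k x : x \in e k -> B k x by rewrite mem_filter => /andP[/set_mem].
have sys : block_system e w.
  split=> [k|k m x /memB/andP[k1 k2] /memB/andP[m1 m2]|k x].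
  - by rewrite filter_uniq// iota_uniq.
  - apply/eqP; rewrite eqn_leq -ltnS -[(m <= k)%N]ltnS.
    rewrite -!(ltr_eXn2l (x := 2 : R)) ?ltr1n//.
    by rewrite (le_lt_trans k1)// (le_lt_trans m1).
  - by rewrite mulr_ge0// invr_ge0 ltW.
have bnd : bounded_blocks e w.
  exists 2 => k; rewrite /w wsumM mulrC ler_pdivrMr//.
  rewrite -exprS; apply: le_trans (@wsum_small_partial_sums _ (N k) (ltW (two_gt0 k.+1))).
  rewrite wsum_setT big_filter -/(wsum _ _ _); apply: le_wsum => // x.
  by case/andP.
have atoms : vanishing_atoms e w.
  move=> eps eps0.
  have fF n : 0 <= f n / F n by rewrite divr_ge0.
  have [|M hM] := (nonneg_cvg0P fF).1 f_small (eps / 2); first by rewrite divr_gt0.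
  have [K hK] := exp2_unbounded (F M + 1).
  exists K => k Kk x /memB/andP[kF Fk].
  have Mx : (M <= x)%N.
    rewrite leqNgt; apply/negP => /ltnW/F_mono FxM.
    by have := hK _ Kk; lra.
  have Fx : 0 < F x by exact: lt_le_trans (two_gt0 k) kF.
  have := hM _ Mx; rewrite ler_pdivrMr// => fx.
  rewrite /w mulrC ler_pdivrMr// (le_trans fx)//.
  have : eps / 2 * F x <= eps / 2 * 2 ^+ k.+1.
    by rewrite ler_wpM2l ?divr_ge0 ?(ltW eps0)// ltW.
  by rewrite exprS; lra.
have dens : density e w `<=` Exh (phi_EU f).
  move=> A dA; rewrite Exh_EU; apply/nonneg_cvg0P => [n|eps eps0].
    by rewrite divr_ge0// wsum_ge0.
  have e2 : 0 < eps / 2 by rewrite divr_gt0.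
  have [j|K hK] := dyadic_average _ dA e2.
    by apply: wsum_ge0; case: sys.
  have [K' hK'] := exp2_unbounded (1 / (eps / 2)).
  have [M hM] := F_oo (2 ^+ (maxn K K')).
  exists M => n /hM/dyadic_floor[k]; rewrite geq_max => /andP[Kk K'k] /andP[kF Fk].
  (* The summand 1 accounts for the indices with [F i < 1], which lie in no block. *)
  have main m : wsum (index_iota 0 n.+1) f (A `&` [set i | F i < 2 ^+ m]) <=
      1 + \sum_(j < m) 2 ^+ j * wsum (e j) (w j) A.
    elim: m => [|m ih].
      rewrite big_ord0 addr0 expr0; apply: le_trans (@wsum_small_partial_sums _ n.+1 ler01).
      by apply: le_wsum => // x [].
    rewrite (wsum_setID _ _ _ [set i | F i < 2 ^+ m]) big_ord_recr /= addrA lerD//.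
      by apply: le_trans ih; apply: le_wsum => // x [[Ax _] xm].
    rewrite /w wsumM mulVKf ?gt_eqF//.
    set X := (X in wsum _ _ X).
    have XB x : X x -> B m x.
      by move=> [[_ /= xm1] /negP]; rewrite -leNgt => xm; rewrite /B /= xm.
    apply: (@le_trans _ _ (wsum (e m) f X)); last first.
      by apply: le_wsum => // x [[]].
    apply: le_wsum_seq => //; rewrite ?filter_uniq ?iota_uniq// => x _ Xx.
    have Bx := XB _ Xx; rewrite mem_filter mem_set// mem_index_iota /= ltnNge.
    by apply/negP => /hN; rewrite leNgt; case/andP: Bx => _ ->.
  rewrite ler_pdivrMr; last exact: lt_le_trans (two_gt0 k) kF.
  apply: (@le_trans _ _ (1 + eps / 2 * 2 ^+ k)).
    apply: le_trans (le_trans (main k.+1) (lerD (lexx _) (hK _ Kk))).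
    apply: le_wsum_in => // x; rewrite mem_index_iota /= => xn Ax; split=> //=.
    by apply: le_lt_trans Fk; exact: F_mono.
  have := hK' _ K'k; rewrite ler_pdivrMr// => h1.
  have : eps * 2 ^+ k <= eps * F n by rewrite ler_wpM2l// ltW.
  by lra.
have [c [cb cd]] := has_small_coloringsS
  (fun A => @density_finite _ e w A sys) (density_small_colorings sys bnd atoms).
by exists c; split=> // p A /(cd p)/dens.
Qed.

End erdos_ulam.

(** * Enumeration of the natural numbers block by block *)

Section enumeration.
Variable t : nat -> seq nat.
Hypothesis t_uniq : forall k, uniq (t k).
Hypothesis t_disj : forall k m x, x \in t k -> x \in t m -> k = m.
Hypothesis t_neq0 : forall k, t k != [::].
Hypothesis t_cover : forall x, exists k, x \in t k.

Fixpoint flat K := if K is K'.+1 then flat K' ++ t K' else [::].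

Lemma mem_flat K x : x \in flat K <-> exists2 k, (k < K)%N & x \in t k.
Proof.
elim: K => [|K ih] /=; first by split=> // -[].
rewrite mem_cat; split=> [/orP[/ih[k kK xk]|xK]|[k]].
- by exists k => //; exact: ltnW.
- by exists K.
- rewrite ltnS leq_eqVlt => /orP[/eqP-> ->|kK xk]; first by rewrite orbT.
  by apply/orP; left; apply/ih; exists k.
Qed.

Lemma flat_uniq K : uniq (flat K).
Proof.
elim: K => //= K ih; rewrite cat_uniq ih t_uniq andbT.
apply/hasPn => x xK; apply/negP => /mem_flat[k kK xk].
by move: kK; rewrite (t_disj xk xK) ltnn.
Qed.

Lemma size_flat_ge K : (K <= size (flat K))%N.
Proof.
elim: K => //= K ih; rewrite size_cat -addn1 leq_add//.
by case: (t K) (t_neq0 K).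
Qed.

Lemma take_flat K L : (K <= L)%N -> take (size (flat K)) (flat L) = flat K.
Proof.
elim: L => [|L ih]; first by rewrite leqn0 => /eqP->.
rewrite leq_eqVlt => /orP[/eqP ->|]; first by rewrite take_size.
rewrite ltnS => KL /=; rewrite take_cat; case: ltnP => h; first exact: ih.
have := ih KL; rewrite take_oversize// => flKL.
by rewrite -flKL subnn take0 cats0.
Qed.

Lemma nth_flat K L n : (n < size (flat K))%N -> (n < size (flat L))%N ->
  nth 0%N (flat K) n = nth 0%N (flat L) n.
Proof.
wlog KL : K L / (K <= L)%N => [h nK nL|nK _].
  by have [/h|/ltnW/h] := leqP K L => h'; [apply: h'|apply/esym; apply: h'].
by rewrite -(take_flat KL) nth_take.
Qed.

(** As blocks are nonempty, the first [n.+1] of them have more than [n] entries, and appending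
    further blocks does not change the [n]-th one. *)
Definition block_enum n := nth 0%N (flat n.+1) n.

Lemma block_enumE K n : (n < size (flat K))%N -> block_enum n = nth 0%N (flat K) n.
Proof. by move=> nK; apply: nth_flat => //; exact: size_flat_ge. Qed.

Lemma block_enum_bij : bijective block_enum.
Proof.
have /choice[b bP] := t_cover.
pose h x := index x (flat (b x).+1).
have xb x : x \in flat (b x).+1 by apply/mem_flat; exists (b x).
have hK : cancel h block_enum.
  move=> x; rewrite (@block_enumE (b x).+1) ?nth_index//.
  by rewrite index_mem.
have inj : injective block_enum.
  move=> m n; pose K := (maxn m n).+1.
  have mK : (m < size (flat K))%N.
    by apply: leq_trans (size_flat_ge K); rewrite ltnS leq_maxl.
  have nK : (n < size (flat K))%N.
    by apply: leq_trans (size_flat_ge K); rewrite ltnS leq_maxr.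
  rewrite (block_enumE mK) (block_enumE nK) => /eqP.
  by rewrite nth_uniq ?flat_uniq// => /eqP.
by exists h => // n; apply: inj; rewrite hK.
Qed.

Lemma block_enum_block n : exists2 k, block_enum n \in t k &
  (size (flat k) <= n < size (flat k.+1))%N.
Proof.
have exP : exists k, (n < size (flat k))%N by exists n.+1; exact: size_flat_ge.
case: (ex_minnP exP) => -[//|k] nk kmin.
have kn : (size (flat k) <= n)%N.
  by rewrite leqNgt; apply/negP => /kmin; rewrite ltnn.
exists k; last by rewrite kn.
rewrite (block_enumE nk) /= nth_cat ltnNge kn /= mem_nth//.
by move: nk; rewrite /= size_cat -ltn_subLR.
Qed.

Lemma size_flat_mono K L : (K <= L)%N -> (size (flat K) <= size (flat L))%N.
Proof. by move=> KL; rewrite -(take_flat KL) size_take_min geq_minr. Qed.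

Variable R : realType.

Lemma wsum_flat K (g : nat -> R) (A : set nat) :
  wsum (flat K) g A = \sum_(j < K) wsum (t j) g A.
Proof.
elim: K => [|K ih]; first by rewrite /wsum big_nil big_ord0.
by rewrite /= wsum_cat ih big_ord_recr.
Qed.

Lemma wsum_block_enum K n (g : nat -> R) (A : set nat) : (n <= size (flat K))%N ->
  wsum (index_iota 0 n) (g \o block_enum) (block_enum @^-1` A) =
  wsum (take n (flat K)) g A.
Proof.
move=> nK; have -> : take n (flat K) = map block_enum (index_iota 0 n).
  rewrite -(map_nth_iota0 0%N nK) /index_iota subn0.
  apply/eq_in_map => i; rewrite mem_iota /= => iN.
  by rewrite (@block_enumE K)// (leq_trans iN).
rewrite /wsum big_map; apply: eq_bigl => i.
by apply/idP/idP; rewrite !inE.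
Qed.

End enumeration.

Section density_to_EU.
Variable R : realType.

(** With weight [2 ^+ k] on block [k], the partial sum [F n] is comparable to [2 ^+ k] for [n] in
    block [k > 0]. The Erdős-Ulam quotients are then controlled by dyadic averages of the block
    masses, and at the end of a block they control its mass. *)
Lemma cover_density_EU (t : nat -> seq nat) (g : nat -> R) (d M : R) :
  block_system t (fun=> g) -> (forall x, exists k, x \in t k) ->
  0 < d -> (forall k, d <= wsum (t k) g setT) ->
  (forall k, wsum (t k) g setT <= M) -> vanishing_atoms t (fun=> g) ->
  exists2 J, is_Erdos_Ulam R J & ideal_isomorphic (density t (fun=> g)) J.
Proof.
move=> sys cover d0 td tM atoms; have [ut disj _g0] := sys.
have g0 : forall x, 0 <= g x := _g0 0%N.
have t0 k : t k != [::].
  apply/eqP => tk; have := td k; rewrite tk /wsum big_nil => h.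
  by have := lt_le_trans d0 h; rewrite ltxx.
have M0 : 0 < M by apply: lt_le_trans d0 (le_trans (td 0%N) (tM 0%N)).
have /choice[b bP] := cover.
have bE k x : x \in t k -> b x = k by move=> xk; exact: disj (bP x) xk.
pose G x := 2 ^+ b x * g x.
have G0 x : 0 <= G x by rewrite mulr_ge0// exprn_ge0.
pose hi := block_enum t; pose f := G \o hi.
have f0 n : 0 <= f n by exact: G0.
pose S A n := wsum (index_iota 0 n.+1) f (hi @^-1` A).
have SE A n K : (n < size (flat t K))%N -> S A n = wsum (take n.+1 (flat t K)) G A.
  by move=> nK; apply: wsum_block_enum.
have tG k A : wsum (t k) G A = 2 ^+ k * wsum (t k) g A.
  rewrite -wsumM /wsum big_seq_cond [RHS]big_seq_cond; apply: eq_bigr => x /andP[xk _].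
  by rewrite /G (bE _ _ xk).
have flatG K A : wsum (flat t K) G A = \sum_(j < K) 2 ^+ j * wsum (t j) g A.
  by rewrite wsum_flat; apply: eq_bigr => j _; rewrite tG.
have tg0 k A : 0 <= wsum (t k) g A by exact: wsum_ge0.
have S_le A n k : (n < size (flat t k.+1))%N ->
    S A n <= \sum_(j < k.+1) 2 ^+ j * wsum (t j) g A.
  move=> nk; rewrite (SE _ _ k.+1)// -flatG.
  by rewrite -[in leRHS](cat_take_drop n.+1 (flat t k.+1)) wsum_cat lerDl wsum_ge0.
pose F n := \sum_(0 <= i < n.+1) f i.
have FE n : F n = S setT n by rewrite /S preimage_setT wsum_setT.
(* Only block [k.-1] is counted, which is exhausted before [n] and has weighted mass at least
   [2 ^+ k.-1 * d]; hence [0 < k], and the factor [d / 2]. *)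
have F_ge n k : (0 < k)%N -> (size (flat t k) <= n)%N -> d / 2 * 2 ^+ k <= F n.
  move=> k0 kn; have nn : (n < size (flat t n.+1))%N by exact: size_flat_ge.
  have kn1 : (k <= n.+1)%N.
    by rewrite (leq_trans (size_flat_ge t0 k))// (leq_trans kn).
  rewrite FE (SE _ _ n.+1)//; apply: (@le_trans _ _ (wsum (flat t k) G setT)).
    rewrite flatG; case: k k0 {kn kn1} => // k _; rewrite big_ord_recr /=.
    rewrite ler_wpDl ?sumr_ge0// => [j _|]; first by rewrite mulr_ge0// exprn_ge0.
    have := td k; rewrite exprS => tdk.
    have : 2 ^+ k * d <= 2 ^+ k * wsum (t k) g setT by rewrite ler_wpM2l// exprn_ge0.
    by lra.
  rewrite -(take_flat t kn1).
  apply: le_wsum_seq => //; rewrite ?take_uniq ?flat_uniq//.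
  by move=> x; rewrite -(take_takel _ (leqW kn)) => /mem_take.
have F_le n k : (n < size (flat t k.+1))%N -> F n <= 2 * M * 2 ^+ k.
  move=> nk; rewrite FE (le_trans (S_le _ _ _ nk))//.
  elim: k {nk} => [|k ih].
    rewrite big_ord_recr big_ord0 /= expr0 add0r mul1r mulr1.
    by have := tM 0%N; lra.
  rewrite big_ord_recr /=.
  have : 2 ^+ k.+1 * wsum (t k.+1) g setT <= 2 ^+ k.+1 * M.
    by rewrite ler_wpM2l// exprn_ge0.
  by move: ih; rewrite exprS; lra.
have blk n : exists2 k, hi n \in t k & (size (flat t k) <= n < size (flat t k.+1))%N.
  exact: block_enum_block.
have blk_ge K n k : (size (flat t K) <= n)%N -> (n < size (flat t k.+1))%N -> (K <= k)%N.
  move=> Kn nk; rewrite leqNgt; apply/negP => kK.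
  have := leq_trans nk (size_flat_mono t kK); by rewrite ltnNge Kn.
have p2 k : 0 < 2 ^+ k :> R by rewrite exprn_gt0.
have F_oo : partial_sums_unbounded f.
  move=> m; have [K hK] := exp2_unbounded (m / (d / 2)).
  exists (size (flat t K.+1)) => n Kn; have := F_ge _ _ (ltn0Sn K) Kn.
  by apply: le_trans; rewrite mulrC -ler_pdivrMr ?divr_gt0// hK.
have F_gt0 n k : (0 < k)%N -> (size (flat t k) <= n)%N -> 0 < F n.
  by move=> k0 /(F_ge _ _ k0); apply: lt_le_trans; rewrite mulr_gt0// divr_gt0.
have F_ge0 n : 0 <= F n by exact: sumr_ge0.
have f_small : f n / F n @[n --> \oo] --> 0.
  apply/nonneg_cvg0P => [n|eps eps0]; first by rewrite divr_ge0.
  have [|N hN] := atoms (eps * d / 2); first by rewrite divr_gt0// mulr_gt0.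
  exists (size (flat t (maxn N 1))) => n Nn; have [k nk /andP[kn nk1]] := blk n.
  have := blk_ge _ _ _ Nn nk1; rewrite geq_max => /andP[Nk k0].
  rewrite ler_pdivrMr ?(F_gt0 _ k)//.
  have := F_ge _ _ k0 kn; have := hN _ Nk _ nk; rewrite /f /= /G (bE _ _ nk) => g1 Fk.
  apply: (@le_trans _ _ (2 ^+ k * (eps * d / 2))); first by rewrite ler_wpM2l// ltW.
  have : eps * (d / 2 * 2 ^+ k) <= eps * F n by rewrite ler_wpM2l// ltW.
  by lra.
exists (Exh (phi_EU f)).
  by exists f; split=> //; apply/partial_sums_unboundedP.
have [h hK hiK] : bijective hi := block_enum_bij ut disj t0 cover.
exists h; split; first by exists hi.
move=> A; rewrite (Exh_EU f0 F_oo) /=.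
have -> : h @` A = hi @^-1` A.
  apply/seteqP; split=> [_ [x Ax <-]|n An]; first by rewrite /preimage /mkset hiK.
  by exists (hi n) => //; rewrite hK.
have th0 n : 0 <= S A n / F n by rewrite divr_ge0// wsum_ge0.
split=> [dA|hA].
  apply/(nonneg_cvg0P th0) => eps eps0.
  have [|K hK'] := @dyadic_average R (fun j => wsum (t j) g A)
      (fun j => tg0 j A) dA (eps * d / 2).
    by rewrite divr_gt0// mulr_gt0.
  exists (size (flat t (maxn K 1))) => n Kn; have [k nk /andP[kn nk1]] := blk n.
  have := blk_ge _ _ _ Kn nk1; rewrite geq_max => /andP[Kk k0].
  rewrite ler_pdivrMr ?(F_gt0 _ k)//.
  apply: le_trans (S_le _ _ _ nk1) (le_trans (hK' _ Kk) _).
  have : eps * (d / 2 * 2 ^+ k) <= eps * F n by rewrite ler_wpM2l ?F_ge// ltW.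
  by lra.
apply/(densityP _ sys) => eps eps0.
have [|N hN] := (nonneg_cvg0P th0).1 hA (eps / (2 * M)).
  by rewrite divr_gt0// mulr_gt0.
exists N.+1 => k Nk.
(* The index [n] is the last one of block [k], so the prefix up to [n] contains that block
   entirely. *)
have [n nE] : exists n, size (flat t k.+1) = n.+1.
  by exists (size (flat t k.+1)).-1; rewrite prednK// (leq_trans _ (size_flat_ge t0 _)).
have nk : (n < size (flat t k.+1))%N by rewrite nE.
have Nn : (N <= n)%N.
  by rewrite -ltnS -nE (leq_trans Nk)// (leq_trans (leqnSn k))// size_flat_ge.
have Fn : 0 < F n.
  apply: (F_gt0 _ k); first exact: leq_trans Nk.
  by rewrite -ltnS -nE /= size_cat -addn1 leq_add2l; case: (t k) (t0 k).
have := hN _ Nn; rewrite ler_pdivrMr// (SE _ _ k.+1)// -nE take_size flatG.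
rewrite big_ord_recr /= => hS.
have := F_le _ _ nk => FM.
rewrite -(ler_pM2l (p2 k)).
have s0 : 0 <= \sum_(i < k) 2 ^+ i * wsum (t i) g A.
  by apply: sumr_ge0 => i _; rewrite mulr_ge0// exprn_ge0.
apply: (@le_trans _ _ (eps / (2 * M) * F n)); first by lra.
have M2 : 0 < 2 * M by rewrite mulr_gt0.
apply: (@le_trans _ _ (eps / (2 * M) * (2 * M * 2 ^+ k))).
  by rewrite ler_wpM2l// ltW// divr_gt0.
by rewrite mulrA divfK ?gt_eqF// mulrC.
Qed.

End density_to_EU.

Section density_EU.
Variables (R : realType) (e : nat -> seq nat) (w : nat -> nat -> R).

(* Each block of a subsequence with masses above [d] absorbs at most one of the
   remaining blocks and at most one point outside of all blocks, so that the new
   blocks cover [nat] and their masses stay bounded away from zero. *)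
Lemma density_EU : block_system e w -> bounded_blocks e w ->
  vanishing_atoms e w -> ~ density e w setT ->
  exists2 J, is_Erdos_Ulam R J & ideal_isomorphic (density e w) J.
Proof.
move=> sys [M hM] atoms nT; have [ue disj w0] := sys.
have [d d0 [l0 l0P]] := density_properP sys nT.
have [l [l_big l_lt]] : exists l : nat -> nat,
    (forall i, d < wsum (e (l i)) (w (l i)) setT) /\ forall i, (l i < l i.+1)%N.
  pose l := fix l i := if i is i'.+1 then l0 (l i').+1 else l0 0%N.
  exists l; split=> i; last by have [] := l0P (l i).+1.
  by case: i => [|i]; [have [] := l0P 0%N|have [] := l0P (l i).+1].
have l_ltn i j : (i < j)%N -> (l i < l j)%N.
  elim: j => // j ih; rewrite ltnS leq_eqVlt => /orP[/eqP->//|/ih h].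
  exact: ltn_trans h (l_lt j).
have l_ge i : (i <= l i)%N by elim: i => // i ih; exact: leq_ltn_trans ih (l_lt i).
have l_inj i j : l i = l j -> i = j.
  by move=> ij; case: (ltngtP i j) => // /l_ltn; rewrite ij ltnn.
have [g1 g1E] := block_glue 0 w sys.
pose inblock x := `[< exists n, x \in e n >].
pose inl k := `[< exists i, l i = k >].
(* Points outside all blocks get weight 0, so absorbing them changes no mass. *)
pose g x := if inblock x then g1 x else 0.
have gE n x : x \in e n -> g x = w n x.
  move=> xn; rewrite /g ifT; first exact: g1E.
  by apply/asboolP; exists n.
have g0 x : 0 <= g x.
  rewrite /g; case: ifPn => // /asboolP[n xn].
  by rewrite (g1E _ _ xn).
pose small k := if inl k then [::] else e k.
pose out k := if inblock k then [::] else [:: k].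
pose t k := e (l k) ++ (small k ++ out k).
have memt k x : x \in t k <->
    [\/ x \in e (l k), ~ (exists i, l i = k) /\ x \in e k |
        ~ (exists n, k \in e n) /\ x = k].
  rewrite /t !mem_cat /small /out; split.
    case/or3P; first by constructor 1.
      by case: ifPn => // /asboolPn; constructor 2.
    by case: ifPn => // /asboolPn ? /[!inE]/eqP; constructor 3.
  case=> [->//|[/asboolPn/negbTE nl xk]|[/asboolPn/negbTE nb ->]].
    by rewrite /inl nl xk orbT.
  by rewrite /inblock nb mem_head !orbT.
have wsumg n A : wsum (e n) g A = wsum (e n) (w n) A.
  rewrite /wsum big_seq_cond [RHS]big_seq_cond; apply: eq_bigr => x /andP[xn _].
  exact: gE.
have tE k A : wsum (t k) g A = wsum (e (l k)) (w (l k)) A +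
    (if inl k then 0 else wsum (e k) (w k) A).
  rewrite /t !wsum_cat wsumg; congr (_ + _).
  have -> : wsum (out k) g A = 0.
    rewrite /out; case: ifPn => h; rewrite /wsum ?big_nil// big_cons big_nil.
    by rewrite /g (negbTE h) addr0 if_same.
  by rewrite addr0 /small; case: ifP => // _; rewrite /wsum big_nil.
have tsys : block_system t (fun=> g).
  split=> [k|k m x /memt xk /memt xm|//].
    rewrite /t cat_uniq ue cat_uniq /small /out; apply/and3P; split=> //.
      apply/hasPn => x /=; rewrite mem_cat => /orP[].
        case: ifPn => // /asboolPn nl xk; apply/negP => xl; apply: nl.
        by exists k; exact: disj xl xk.
      case: ifPn => // /asboolPn nb; rewrite inE => /eqP ->; apply/negP => kl.
      by apply: nb; exists (l k).
    apply/and3P; split; [by case: ifP| |by case: ifP].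
    apply/hasPn => x; case: ifPn => // /asboolPn nb; rewrite inE => /eqP ->.
    by case: ifP => // _; apply/negP => kk; apply: nb; exists k.
  case: xk => [xk|[nl xk]|[nb xk]]; case: xm => [xm|[nl' xm]|[nb' xm]].
  - exact/l_inj/(disj _ _ _ xk xm).
  - by exfalso; apply: nl'; exists k; exact: disj xk xm.
  - by exfalso; apply: nb'; exists (l k); rewrite -xm.
  - by exfalso; apply: nl; exists m; exact: disj xm xk.
  - exact: disj xk xm.
  - by exfalso; apply: nb'; exists k; rewrite -xm.
  - by exfalso; apply: nb; exists (l m); rewrite -xk.
  - by exfalso; apply: nb; exists m; rewrite -xk.
  - by rewrite -xk.
have cover x : exists k, x \in t k.
  have [[n xn]|nb] := pselect (exists n, x \in e n); last first.
    by exists x; apply/memt; constructor 3.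
  have [[i li]|nl] := pselect (exists i, l i = n).
    by exists i; apply/memt; constructor 1; rewrite li.
  by exists n; apply/memt; constructor 2.
have w'0 n A : 0 <= wsum (e n) (w n) A by exact: wsum_ge0.
have dens : density e w = density t (fun=> g).
  apply/seteqP; split=> A /(densityP _ _) h; apply/densityP => // eps eps0.
    have [//||N hN] := h _ (eps / 2); first by rewrite divr_gt0.
    exists N => k Nk; rewrite tE.
    have h1 := hN _ (leq_trans Nk (l_ge k)); have h2 := hN _ Nk.
    by case: ifP => _; lra.
  (* If block [n] is the heavy block [l i], it is now part of block [i], and [l N <= n] is what
     gives [N <= i]. *)
  have [//|N hN] := h _ eps eps0; exists (maxn N (l N)) => n.
  rewrite geq_max => /andP[Nn lNn].
  have [[i li]|nl] := pselect (exists i, l i = n).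
    have Ni : (N <= i)%N.
      by rewrite leqNgt; apply/negP => /l_ltn; rewrite li ltnNge lNn.
    apply: le_trans (hN _ Ni); rewrite tE -li lerDl.
    by case: ifP.
  apply: le_trans (hN _ Nn); rewrite tE /inl ifF ?lerDr//.
  by apply/asboolPn.
rewrite dens; apply: (@cover_density_EU _ t g d (M + M)) => //.
- by move=> k; rewrite tE; have := l_big k; have := w'0 k setT; case: ifP; lra.
- move=> k; rewrite tE; have := hM (l k); have := hM k; have := w'0 (l k) setT.
  by have := w'0 k setT; case: ifP; lra.
- move=> eps eps0; have [N hN] := atoms _ eps0; exists N => k Nk x /memt.
  case=> [xl|[_ xk]|[nb ->]].
  - by rewrite (gE _ _ xl) (hN (l k))// (leq_trans Nk).
  - by rewrite (gE _ _ xk) (hN k).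
  - by rewrite /g ifF ?ltW//; apply/asboolPn.
Qed.

End density_EU.

(** * Reduction of the theorem to block systems *)

Section density_zero.
Variable R : realType.

Definition dyadic_block n := index_iota (2 ^ n) (2 ^ n.+1).
Definition dyadic_weight (n x : nat) : R := 2 ^- n.

Lemma density_zeroE : density_zero_ideal R = density dyadic_block dyadic_weight.
Proof.
have E A : (fun n => (\sum_(2 ^ n <= i < 2 ^ n.+1) (i \in A))%N%:R / 2 ^+ n : R) =
    (fun n => wsum (dyadic_block n) (dyadic_weight n) A).
  apply/funext => n; rewrite natr_sum mulr_suml /wsum [RHS]big_mkcond /=.
  apply: eq_bigr => i _; rewrite /dyadic_weight.
  by case: (i \in A); rewrite ?mul1r ?mul0r.
by apply/seteqP; split=> A; rewrite /density_zero_ideal /density /mkset E.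
Qed.

Lemma dyadic_block_system : block_system dyadic_block dyadic_weight.
Proof.
split=> [n|n m x|n x]; first exact: iota_uniq.
- rewrite !mem_index_iota => /andP[n1 n2] /andP[m1 m2].
  apply/eqP; rewrite eqn_leq; apply/andP; split.
    by rewrite -ltnS -(ltn_exp2l _ _ (ltnSn 1)); exact: leq_ltn_trans n1 m2.
  by rewrite -ltnS -(ltn_exp2l _ _ (ltnSn 1)); exact: leq_ltn_trans m1 n2.
- by rewrite invr_ge0 exprn_ge0.
Qed.

Lemma dyadic_block_mass n : wsum (dyadic_block n) (dyadic_weight n) setT = 1.
Proof.
rewrite wsum_setT big_const_seq count_predT iter_addr_0 size_iota expnS mul2n.
by rewrite -addnn addnK /dyadic_weight -[LHS]mulr_natr natrX mulVf.
Qed.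

Lemma dyadic_vanishing_atoms : vanishing_atoms dyadic_block dyadic_weight.
Proof.
move=> eps eps0; have [K hK] := exp2_unbounded eps^-1; exists K => n /hK h x _.
by rewrite /dyadic_weight invf_ple ?posrE ?exprn_gt0.
Qed.

Lemma dyadic_bounded_blocks : bounded_blocks dyadic_block dyadic_weight.
Proof. by exists 1 => n; rewrite dyadic_block_mass. Qed.

Lemma dyadic_density_proper : ~ density dyadic_block dyadic_weight setT.
Proof.
move=> /(densityP _ dyadic_block_system)/(_ (1 / 2))[|N /(_ N (leqnn N))].
  by lra.
by rewrite dyadic_block_mass; lra.
Qed.

End density_zero.

(** * Finitely supported measures as finite sums *)

Section finitely_supported_measures.
Variables (R : realType) (m : {finite_measure set nat -> \bar R}).

Let wt x : R := fine (m [set x]).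

Lemma measure_nat_finite s X : uniq s ->
  m (X `&` [set` s]) = (wsum s wt X)%:E.
Proof.
elim: s => [_|x s ih /= /andP[xs us]].
  by rewrite set_nil setI0 measure0 /wsum big_nil.
have -> : X `&` [set` x :: s] = (X `&` [set x]) `|` (X `&` [set` s]).
  rewrite -setIUr; congr (_ `&` _); apply/seteqP; split=> y /=; rewrite in_cons.
    by move=> /orP[/eqP|]; [left|right].
  by move=> [->|->]; rewrite ?eqxx ?orbT.
rewrite measureU//; last first.
  by apply/seteqP; split=> // y [[_ ->] [_ /=]]; rewrite (negbTE xs).
rewrite [X in (_ + X)%E](ih us) /wsum big_cons; case: ifPn => [/set_mem Xx|/negP Xx].
  rewrite EFinD /wt fineK ?fin_num_measure//; congr (m _ + _)%E.
  by apply/setIidPr => _ ->.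
rewrite (_ : X `&` [set x] = set0) ?measure0 ?add0e//.
by apply/seteqP; split=> // y [Xy yx]; apply: Xx; rewrite inE -yx.
Qed.

Lemma measure_nat_null X : (forall x, X x -> m [set x] = 0%E) -> m X = 0%E.
Proof.
move=> X0; have -> : X = \bigcup_x (X `&` [set x]).
  by rewrite -setI_bigcupr; apply/esym/setIidPl => x _; exists x.
rewrite measure_bigcup//=; last first.
  apply/trivIsetP => i j _ _ ij; apply/seteqP; split=> // x [[_ ->] [_ /eqP]].
  by rewrite (negbTE ij).
apply: eseries0 => i _ _.
have [Xi|Xi] := pselect (X i); last first.
  rewrite (_ : X `&` [set i] = set0) ?measure0//.
  by apply/seteqP; split=> // x [Xx xi]; apply: Xi; rewrite -xi.
by rewrite (_ : X `&` [set i] = [set i]) ?X0//; apply/setIidPr => _ ->.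
Qed.

Lemma measure_nat_wsum s X : uniq s -> [set` s] = supp m ->
  m X = (wsum s wt X)%:E.
Proof.
move=> us sE; rewrite -[X in m X](setUIDK X [set` s]) measureU//; last first.
  by apply/seteqP; split=> // x [[_ ?] [_]].
rewrite [Y in (Y + _)%E](measure_nat_finite _ us).
rewrite [Y in (_ + Y)%E]measure_nat_null ?adde0// => x [_].
by rewrite sE /supp /= => /negP; rewrite negbK => /eqP.
Qed.

End finitely_supported_measures.

Lemma density_idealE (R : realType) (mu : nat -> {finite_measure set nat -> \bar R}) :
  (forall n, finite_set (supp (mu n))) -> trivIset setT (fun n => supp (mu n)) ->
  exists e, exists w : nat -> nat -> R,
  [/\ block_system e w, density_ideal mu = density e w &
    (bounded_blocks e w /\ vanishing_atoms e w <->
     (ereal_sup [set mu n setT | n in setT] < +oo)%E /\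
       at_plus (mu n) @[n --> \oo] --> 0%E)].
Proof.
move=> fin triv.
have /choice[e eP] : forall n, exists s : seq nat, uniq s /\ [set` s] = supp (mu n).
  move=> n; have /finite_seqP[s sE] := fin n; exists (undup s).
  rewrite undup_uniq; split=> //; rewrite sE.
  by apply/seteqP; split=> x /=; rewrite mem_undup.
have ue n : uniq (e n) by case: (eP n).
have eE n : [set` e n] = supp (mu n) by case: (eP n).
pose w n x : R := fine (mu n [set x]).
have muE n X : mu n X = (wsum (e n) (w n) X)%:E by exact: measure_nat_wsum.
have w0 n x : 0 <= w n x by rewrite fine_ge0.
have wE n x : mu n [set x] = (w n x)%:E by rewrite /w fineK ?fin_num_measure.
have sys : block_system e w.
  split=> // n m x xn xm; apply: (triv n m I I); exists x; split.
    by rewrite -eE.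
  by rewrite -eE.
exists e, w; split=> //.
  apply/seteqP; split=> X /=.
    move=> /nonneg_ecvg0P h; apply/(densityP _ sys) => eps eps0.
    by have [//|N hN] := h _ eps eps0; exists N => n /hN; rewrite muE lee_fin.
  move=> /(densityP _ sys) h; apply/nonneg_ecvg0P => // eps eps0.
  by have [N hN] := h _ eps0; exists N => n /hN; rewrite muE lee_fin.
have at_ge0 n : (0 <= at_plus (mu n))%E.
  by apply: le_trans (measure_ge0 (mu n) [set 0%N]) (ereal_sup_ubound _); exists 0%N.
have sup_ge0 : (0 <= ereal_sup [set mu n setT | n in setT])%E.
  by apply: le_trans (measure_ge0 (mu 0%N) setT) (ereal_sup_ubound _); exists 0%N.
split=> [[[M hM] atoms]|[sup_lt at0]].
  split.
    apply: (@le_lt_trans _ _ M%:E); last exact: ltry.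
    by apply/ereal_supP => _ [n _ <-]; rewrite muE lee_fin.
  apply/nonneg_ecvg0P => // eps eps0; have [N hN] := atoms _ eps0.
  exists N => n Nn; apply/ereal_supP => _ [x _ <-]; rewrite wE lee_fin.
  have [xn|xn] := boolP (x \in e n); first exact: hN.
  have : ~ supp (mu n) x by rewrite -eE; exact/negP.
  by rewrite /supp /= wE eqe => /negP; rewrite negbK => /eqP->; exact: ltW.
split.
  exists (fine (ereal_sup [set mu n setT | n in setT])) => n.
  rewrite -lee_fin fineK ?ge0_fin_numE// -muE; apply: ereal_sup_ubound.
  by exists n.
move=> eps eps0; have [//|N hN] := (nonneg_ecvg0P at_ge0).1 at0 eps.
exists N => n /hN h x _; rewrite -lee_fin -wE.
by apply: le_trans h; apply: ereal_sup_ubound; exists x.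
Qed.

Lemma isomorphic_katetov (I J : set_system nat) :
  ideal_isomorphic I J -> katetov_le J I.
Proof.
move=> [h [[g hg gh] hIJ]]; exists h => A JA; apply/hIJ.
rewrite (_ : h @` (h @^-1` A) = A)//; apply/seteqP; split=> [_ [x Ax <-]//|x Ax].
by exists (g x); rewrite /preimage /mkset ?gh.
Qed.

Theorem mainTheorem4 (R : realType)
    (mu : nat -> {finite_measure set nat -> \bar R})
    (mu_supp : forall n, finite_set (supp (mu n)))
    (mu_disj : trivIset setT (fun n => supp (mu n)))
    (mu_ideal : is_ideal (density_ideal mu)) :
  let I := density_ideal mu in
  [<-> exists2 J, is_Erdos_Ulam R J & ideal_isomorphic I J;
       ~ Bolzano_Weierstrass R I;
       (ereal_sup [set mu n setT | n in setT] < +oo)%E /\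
         at_plus (mu n) @[n --> \oo] --> 0%E;
       has_countable_splitting_family I;
       totally_bounded_ideal R I;
       katetov_equiv I (density_zero_ideal R);
       Nikodym_filter R (dual_filter I)].
Proof.
move=> I; have [e [w [sys IE measuresE]]] := density_idealE mu_supp mu_disj.
rewrite -/I in IE.
have idI : is_ideal I by [].
have properI : ~ density e w setT by rewrite -IE; exact: ideal_proper.
(* The hub of the cycle: with [bounded_nUV], boundedness with vanishing atoms amounts to the failure
   of [unbounded_vanishing]. *)
have nUV_bounded : ~ unbounded_vanishing R I ->
    bounded_blocks e w /\ vanishing_atoms e w.
  move=> nUV; apply: contrapT => nb; apply: nUV; rewrite IE.
  exact: not_bounded_unbounded_vanishing.
have tb_nUV : totally_bounded_ideal R I -> ~ unbounded_vanishing R I.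
  by rewrite IE => tb UV; apply: (unbounded_vanishing_not_tb sys) => //; rewrite -IE.
have colorings_nUV : has_small_colorings I finite_set -> ~ unbounded_vanishing R I.
  by move=> /(small_colorings_totally_bounded (R := R))/tb_nUV.
have bounded_colorings : bounded_blocks e w /\ vanishing_atoms e w ->
    has_small_colorings I I.
  by rewrite IE => -[bnd atoms]; exact: density_small_colorings.
have bounded_nUV : bounded_blocks e w /\ vanishing_atoms e w ->
    ~ unbounded_vanishing R I.
  move=> /bounded_colorings cI; apply/colorings_nUV/(has_small_coloringsS _ cI).
  by move=> A; exact: ideal_finite.
have splitting_nBW : has_countable_splitting_family I -> ~ Bolzano_Weierstrass R I.
  exact: countable_splitting_nBW.
tfae.
(* The small colourings of the Erdős-Ulam ideal pass to [I] along the isomorphism, so [I] has no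
   unbounded vanishing measures. The blocks are therefore bounded with vanishing atoms, which yields
   a splitting family. *)
- move=> [J [f [f0 /(partial_sums_unboundedP f0) foo fsmall ->]] /isomorphic_katetov EI].
  apply/splitting_nBW/small_colorings_splitting/bounded_colorings/nUV_bounded => //.
  apply/colorings_nUV/(katetov_small_colorings idI EI).
  exact: EU_small_colorings.
- move=> nBW; apply/measuresE/nUV_bounded/tb_nUV.
  exact: not_BW_totally_bounded.
- by move=> /measuresE/bounded_colorings; exact: small_colorings_splitting.
- by move=> /splitting_nBW; exact: not_BW_totally_bounded.
- move=> /tb_nUV/nUV_bounded[bnd atoms]; rewrite density_zeroE IE.
  split; apply: density_katetov => //.
  + exact: dyadic_block_system.
  + exact: dyadic_bounded_blocks.
  + exact: dyadic_vanishing_atoms.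
  + exact: dyadic_block_system.
  + exact: dyadic_density_proper.
(* The reduction of the density zero ideal to [I] transfers its small colourings to [I]. *)
- move=> [_ ZI] ; apply: contrapT => /(not_Nikodym_unbounded_vanishing idI).
  apply/colorings_nUV/(katetov_small_colorings idI ZI); rewrite density_zeroE.
  apply: (@has_small_coloringsS _ (density dyadic_block (@dyadic_weight R))).
    by move=> A; apply: density_finite; exact: dyadic_block_system.
  apply: density_small_colorings.
  + exact: dyadic_block_system.
  + exact: dyadic_bounded_blocks.
  + exact: dyadic_vanishing_atoms.
- move=> nik; rewrite IE.
  have [bnd atoms] : bounded_blocks e w /\ vanishing_atoms e w.
    by apply: nUV_bounded => UV; exact: (unbounded_vanishing_not_Nikodym idI UV).
  exact: density_EU.
Qed.
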